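(* Let $F$ be a probability distribution on $[0,\infty)$ having a density, with finite mean $\mu$ and finite variance $\sigma^2$. For the nearest neighbor tour on $n\ge 3$ cities in the mean field traveling salesman problem with intercity distance distribution $F$, let $L_n^{\mathrm{first}}:=\min_{1<j\le n}L_{1j}$ be the length of the first edge and let $L_n^{\mathrm{last}}$ be the length of the last edge, which joins the last visited city to the first city. Then: (i) the distribution function of $L_n^{\mathrm{first}}+L_n^{\mathrm{last}}$ converges to $F$ as $n\to\infty$ (convergence in distribution); (ii) $\sum_{i=2}^{n-1}\min_{i<j\le n}L_{ij}$ is independent of $L_n^{\mathrm{first}}+L_n^{\mathrm{last}}$; (iii) as $n\to\infty$, $$\mathbb{E}\left[L_n^{\mathrm{first}}+L_n^{\mathrm{last}}\right]\longrightarrow\mu\qquad\text{and}\qquad \mathbb{E}\left[\left(L_n^{\mathrm{first}}+L_n^{\mathrm{last}}\right)^2\right]\longrightarrow\mu^2+\sigma^2 .$$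
   Context: Mean field traveling salesman problem: there are $n$ cities $1,2,\dots,n$, and the intercity distances $L_{ij}=L_{ji}$, $1\le i<j\le n$, are i.i.d. random variables with distribution $F$ (no triangle inequality is required). Nearest neighbor (NN) tour: start at $v_1=1$; given $v_1,\dots,v_i$ with $i<n$, let $v_{i+1}$ be the city $u\notin\{v_1,\dots,v_i\}$ minimizing $L_{v_i u}$ (ties broken arbitrarily; they have probability zero when $F$ has a density); after all cities are visited, return to city $1$, i.e. $v_{n+1}=1$. Thus $L_n^{\mathrm{first}}=L_{v_1v_2}$ and $L_n^{\mathrm{last}}=L_{v_n 1}$.
   Formalization: Parts (i) and (iii) additionally assume F([0,x])>0 for every x>0 (support of F starts at 0); without this they fail, e.g. for F uniform on [1,2], where the first and last edges always sum to at least 2. *)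

(* Defs.v *)
From HB Require Import structures.
From mathcomp Require Export all_boot all_order all_algebra.
From mathcomp Require Export all_classical all_reals all_analysis.

Set Implicit Arguments.
Unset Strict Implicit.
Unset Printing Implicit Defensive.

Export Order.TTheory GRing.Theory Num.Theory.
Export numFieldNormedType.Exports.

Local Open Scope classical_set_scope.
Local Open Scope ring_scope.

(* Mutual independence of the real random variables X i, i in D: the product
   rule over every (finite) subfamily. *)
Definition mutually_independent d (T : measurableType d) (R : realType)
    (P : probability T R) (I : finType) (D : {pred I}) (X : I -> T -> R) : Prop :=
  forall J : {set I}, {subset J <= D} ->
  forall B : I -> set R, (forall i, measurable (B i)) ->
    P (\bigcap_(i in [set` J]) (X i @^-1` B i)) =
    (\prod_(i in J) P (X i @^-1` B i))%E.

Definition independent_pair d (T : measurableType d) (R : realType)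
    (P : probability T R) (X Y : T -> R) : Prop :=
  forall A B : set R, measurable A -> measurable B ->
    P (X @^-1` A `&` Y @^-1` B) = (P (X @^-1` A) * P (Y @^-1` B))%E.

Definition has_density (R : realType) (F : probability R R) : Prop :=
  exists f : R -> R,
    [/\ measurable_fun setT f, (forall x, 0 <= f x) &
        forall A : set R, measurable A ->
          F A = (\int[lebesgue_measure]_(x in A) (f x)%:E)%E].

(* The set of cities is 'I_n.+1, i.e. there are n.+1 cities, and city k is the
   ordinal k - 1; in particular city 1 is ord0. *)

Definition iid_distances d (T : measurableType d) (R : realType)
    (P : probability T R) (F : probability R R) (n : nat)
    (L : 'I_n.+1 -> 'I_n.+1 -> {RV P >-> R}) : Prop :=
  [/\ forall i j w, L i j w = L j i w,
      forall i j : 'I_n.+1, (i < j)%N ->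
        forall A : set R, measurable A -> distribution P (L i j) A = F A &
      mutually_independent P [pred p : 'I_n.+1 * 'I_n.+1 | (p.1 < p.2)%N]
        (fun p => L p.1 p.2)].

(* v lists the cities in the order of a nearest neighbor tour started at city 1
   (v i is the city in position i); ties may be broken in any way, so v is in
   general not determined by the distances l. *)
Definition nn_tour (R : realType) (n : nat) (l : 'I_n.+1 -> 'I_n.+1 -> R)
    (v : 'I_n.+1 -> 'I_n.+1) : Prop :=
  v ord0 = ord0 /\
  forall i j : 'I_n.+1, j = i.+1 :> nat ->
    let unvisited u := forall k : 'I_n.+1, (k <= i)%N -> u <> v k in
    unvisited (v j) /\ forall u, unvisited u -> l (v i) (v j) <= l (v i) u.

(* Minimum of l i j over j > i. For i < n the default value l i ord_max is one
   of the minimized values. *)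
Definition min_later (R : realType) (n : nat) (l : 'I_n.+1 -> 'I_n.+1 -> R)
    (i : 'I_n.+1) : R :=
  \big[Num.min/l i ord_max]_(j < n.+1 | (i < j)%N) l i j.

Definition Lfirst (R : realType) (n : nat) (l : 'I_n.+1 -> 'I_n.+1 -> R) : R :=
  min_later l ord0.

Definition Llast (R : realType) (n : nat) (l : 'I_n.+1 -> 'I_n.+1 -> R)
    (v : 'I_n.+1 -> 'I_n.+1) : R :=
  l (v ord_max) ord0.

(* With N = n.+1 cities this is the sum over cities i = 2, ..., N - 1, which are
   the ordinals 1, ..., n - 1. *)
Definition middle_sum (R : realType) (n : nat) (l : 'I_n.+1 -> 'I_n.+1 -> R) : R :=
  \sum_(i < n.+1 | (0 < i < n)%N) min_later l i.

(* 0 is the left endpoint of the support of F. This is what makes the length of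
   the first edge vanish asymptotically: if F is uniform on [1, 2], say, then the
   first and last edges always add up to at least 2. *)
Definition support_starts_at_0 (R : realType) (F : probability R R) : Prop :=
  forall x : R, 0 < x -> (0 < F `[0%R, x]%classic)%E.

(* Main.v *)
(* Call the edges at city 1 the star.  Almost surely no two edge
   lengths agree, and then the second city of the tour is the far end of the
   shortest star edge, while the last city is a function of the second city and
   of the edges outside the star.  The star is independent of the other edges
   and its edges are exchangeable, so for every k <> m the event that the tour
   starts with k and ends with m, intersected with an event on
   (L_first, L_last), factors into a part that does not depend on (k, m) and a
   part that lives outside the star.  Summing over (k, m) shows that
   (L_first, L_last) is independent of everything outside the star, which gives
   (ii), and that L_last is distributed as a uniformly chosen non-minimal star
   edge.  With N cities the latter reads
     (N - 2) P(L_last in B) + P(L_first in B) = (N - 1) F(B).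
   Integrating against |x| and x^2, the limits of the moments of L_last follow
   once E[L_first^2] -> 0, and the latter holds because
   E[L_first^2] <= e^2 + F(]e, oo[)^(N-2) E[L_12^2]. *)
Require Import Defs.
From mathcomp Require Import perm ring lra measurable_realfun.

Set Implicit Arguments.
Unset Strict Implicit.
Unset Printing Implicit Defensive.

Local Open Scope classical_set_scope.
Local Open Scope ring_scope.

(** * Cylinder sets and independence *)

Section cylinders.
Context (R : realType) (I : finType).

(** Boxes constrain only the coordinates in J but live in the full space [I -> R], so that events
    for different J can be intersected directly. *)
Definition boxes (J : {set I}) : set (set (I -> R)) :=
  [set E | exists2 B : I -> set R, (forall i, measurable (B i)) &
    E = [set x | forall i, i \in J -> B i (x i)]].

Lemma boxes_setI_closed J : setI_closed (boxes J).
Proof.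
move=> _ _ [B mB ->] [C mC ->]; exists (fun i => B i `&` C i).
  by move=> i; exact: measurableI.
apply/seteqP; split => x /=.
  by move=> [Bx Cx] i iJ; split; [exact: Bx|exact: Cx].
by move=> BCx; split => i /BCx[].
Qed.

Lemma boxes_setT J : boxes J setT.
Proof. by exists (fun=> setT) => //; apply/seteqP; split. Qed.

(** Measurability on this type encodes dependence on the coordinates in J alone. *)
Definition cylinders (J : {set I}) := g_sigma_algebraType (boxes J).

Lemma measurable_coord (J : {set I}) i : i \in J ->
  measurable_fun [set: cylinders J] (fun x => x i).
Proof.
move=> iJ _ B mB; rewrite setTI; apply: sub_sigma_algebra.
exists (fun j => if j == i then B else setT).
  by move=> j; case: ifP.
apply/seteqP; split => x /=; first by move=> Bx j _; case: eqP => // ->.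
by move=> /(_ i iJ); rewrite eqxx.
Qed.

Lemma measurable_to_cylinders d (T : measurableType d) (J : {set I})
    (X : I -> T -> R) : (forall i, measurable_fun setT (X i)) ->
  measurable_fun setT ((fun w i => X i w) : T -> cylinders J).
Proof.
move=> mX; apply: measurability => //.
move=> _ [_ [B mB ->] <-]; rewrite setTI.
rewrite (_ : _ @^-1` _ = \bigcap_(i in [set` J]) (X i @^-1` B i)) //.
apply: fin_bigcap_measurable => //.
by move=> i _; rewrite -[X in measurable X]setTI; exact: mX.
Qed.

Lemma measurable_cylinder_preimage d (T : measurableType d) (J : {set I})
    (X : I -> T -> R) E : (forall i, measurable_fun setT (X i)) ->
  <<s boxes J >> E -> measurable [set w | E (fun i => X i w)].
Proof.
move=> /(@measurable_to_cylinders _ _ J) mX sE.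
rewrite (_ : [set _ | _] = setT `&` (fun w i => X i w) @^-1` E).
  exact: mX.
by rewrite setTI.
Qed.

(** Boxes form a pi-system containing the whole space, so agreement of finite measures on them
    extends to the generated sigma-algebra. Arbitrary measures are allowed because restrictions and
    multiples of P are compared below. *)
Lemma cylinders_law_unique d1 d2 (T1 : measurableType d1)
    (T2 : measurableType d2) (J : {set I})
    (P1 : {measure set T1 -> \bar R}) (P2 : {measure set T2 -> \bar R})
    (X : I -> T1 -> R) (Y : I -> T2 -> R) :
  (forall i, measurable_fun setT (X i)) ->
  (forall i, measurable_fun setT (Y i)) ->
  (P1 setT < +oo)%E ->
  (forall E, boxes J E ->
     P1 [set w | E (fun i => X i w)] = P2 [set w | E (fun i => Y i w)]) ->
  forall E, <<s boxes J >> E ->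
     P1 [set w | E (fun i => X i w)] = P2 [set w | E (fun i => Y i w)].
Proof.
move=> mX mY P1oo PE E sE.
have mX' := measurable_to_cylinders (J := J) mX.
have mY' := measurable_to_cylinders (J := J) mY.
rewrite -[LHS]/(pushforward P1 ((fun w i => X i w) : T1 -> cylinders J) E).
rewrite -[RHS]/(pushforward P2 ((fun w i => Y i w) : T2 -> cylinders J) E).
apply: (@measure_unique _ R (cylinders J) (boxes J) (fun=> setT)) => //.
- exact: boxes_setI_closed.
- by move=> _; exact: boxes_setT.
- by apply/seteqP; split => // x _; exists 0%N.
Qed.

End cylinders.

Section independence.
Context (R : realType) (I : finType) d (T : measurableType d)
  (P : probability T R) (D : {pred I}) (X : I -> T -> R).
Hypothesis mX : forall i, measurable_fun setT (X i).
Hypothesis indepX : mutually_independent P D X.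

(** The product rule is extended from boxes one factor at a time: with one event fixed, both sides
    are finite measures in the other, namely a restriction of P and a multiple of P. *)
Lemma independent_cylinders (J1 J2 : {set I}) (E1 E2 : set (I -> R)) :
  {subset J1 <= D} -> {subset J2 <= D} -> [disjoint J1 & J2]%B ->
  <<s boxes J1 >> E1 -> <<s boxes J2 >> E2 ->
  P ([set w | E1 (fun i => X i w)] `&` [set w | E2 (fun i => X i w)]) =
  (P [set w | E1 (fun i => X i w)] * P [set w | E2 (fun i => X i w)])%E.
Proof.
move=> J1D J2D J12 sE1 sE2.
have product_rule (J : {set I}) (B : I -> set R) : {subset J <= D} ->
    (forall i, measurable (B i)) ->
    P [set w | forall i, i \in J -> B i (X i w)] =
    (\prod_(i in J) P (X i @^-1` B i))%E.
  move=> JD mB; rewrite -indepX //.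
have boxE1 F1 F2 : boxes J1 F1 -> boxes J2 F2 ->
    P ([set w | F1 (fun i => X i w)] `&` [set w | F2 (fun i => X i w)]) =
    (P [set w | F1 (fun i => X i w)] * P [set w | F2 (fun i => X i w)])%E.
  move=> [B mB ->] [C mC ->].
  rewrite /= !product_rule//.
  (* As J1 and J2 are disjoint, a single family carries both boxes, and its product over the union
     splits. *)
  pose BC i := if i \in J1 then B i else C i.
  rewrite (_ : _ `&` _ = [set w | forall i, i \in J1 :|: J2 -> BC i (X i w)]).
    rewrite product_rule; last first.
    - by move=> i; rewrite /BC; case: ifP.
    - by move=> i; rewrite inE => /orP[/J1D|/J2D].
    rewrite (eq_bigl [predU J1 & J2]); last by move=> i; rewrite !inE.
    rewrite bigU//=; congr (_ * _)%E; apply: eq_bigr => i iJ; rewrite /BC ?iJ//.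
    by rewrite (disjointFl J12).
  apply/seteqP; split => w /=.
    move=> [Bw Cw] i; rewrite inE /BC; case: ifPn => iJ /=.
      by move=> _; exact: Bw.
    exact: Cw.
  move=> BCw; split => i iJ; move: (BCw i); rewrite inE /BC iJ ?orbT.
    by apply.
  by rewrite (disjointFl J12)//; apply.
have mE2 := measurable_cylinder_preimage mX sE2.
have half F1 : boxes J1 F1 ->
    P ([set w | F1 (fun i => X i w)] `&` [set w | E2 (fun i => X i w)]) =
    (P [set w | F1 (fun i => X i w)] * P [set w | E2 (fun i => X i w)])%E.
  move=> bF1.
  have mF1 := measurable_cylinder_preimage mX (@sub_sigma_algebra _ _ _ _ bF1).
  have pF1 : 0 <= fine (P [set w | F1 (fun i => X i w)]) by rewrite fine_ge0.
  rewrite setIC; have /= := @cylinders_law_unique R I _ _ T T J2 (mrestr P mF1)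
    (mscale (NngNum pF1) P) X X mX mX _ _ E2 sE2.
  rewrite /mrestr /mscale /= fineK ?fin_num_measure//; apply.
  - rewrite setTI; apply: le_lt_trans (probability_le1 _ mF1) _; exact: ltry.
  - by move=> F2 bF2; rewrite setIC boxE1.
have pE2 : 0 <= fine (P [set w | E2 (fun i => X i w)]) by rewrite fine_ge0.
have /= := @cylinders_law_unique R I _ _ T T J1 (mrestr P mE2)
    (mscale (NngNum pE2) P) X X mX mX _ _ E1 sE1.
rewrite /mrestr /mscale /= fineK ?fin_num_measure// => ->; last 2 first.
- rewrite setTI; apply: le_lt_trans (probability_le1 _ mE2) _; exact: ltry.
- by move=> F1 bF1; rewrite half// muleC.
by rewrite muleC.
Qed.

(** On a box, the relabelled and the original family both give the product of the same
    one-coordinate laws. *)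
Lemma exchangeable_cylinders (F : set R -> \bar R) (J : {set I}) (f : I -> I)
    (E : set (I -> R)) :
  {subset J <= D} -> {in J &, injective f} -> {in J, forall i, f i \in D} ->
  (forall i B, i \in D -> measurable B -> P (X i @^-1` B) = F B) ->
  <<s boxes J >> E ->
  P [set w | E (fun i => X (f i) w)] = P [set w | E (fun i => X i w)].
Proof.
move=> JD finj fD lawX sE.
apply: (@cylinders_law_unique _ _ _ _ _ _ J P P (fun i => X (f i)) X) => //.
  by apply: le_lt_trans (probability_le1 _ _) _ => //; rewrite ltry.
move=> _ [B mB ->] /=.
(* [C] moves the constraint at i to the coordinate [f i]; injectivity of f on J makes the picked
   preimage unique. *)
pose C j := if [pick i in J | f i == j] is Some i then B i else setT.
have Cf i : i \in J -> C (f i) = B i.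
  move=> iJ; rewrite /C; case: pickP => [k /andP[kJ /eqP/finj ->//]|/(_ i)].
  by rewrite iJ eqxx.
transitivity (\prod_(j in f @: J) P (X j @^-1` C j))%E.
  rewrite -indepX; last 2 first.
  - by move=> j /imsetP[i iJ ->]; exact: fD.
  - by move=> j; rewrite /C; case: pickP.
  congr (P _); apply/seteqP; split => w /=.
    by move=> Bw j /imsetP[i iJ ->] /=; rewrite Cf//; exact: Bw.
  by move=> Cw i iJ; rewrite -(Cf i iJ); apply: Cw; exact: imset_f.
rewrite big_imset//= (eq_bigr (fun i => P (X i @^-1` B i))).
  by rewrite -indepX.
by move=> i iJ; rewrite Cf// !lawX//; [exact: JD|exact: fD].
Qed.

End independence.

Lemma has_density_set1 (R : realType) (F : probability R R) (x : R) :
  has_density F -> F [set x] = 0%E.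
Proof.
move=> [f [mf f0 ->//]]; apply: null_set_integral => //.
- by apply/measurable_EFinP; exact: measurable_funTS.
- exact: lebesgue_measure_set1.
Qed.

(** * Null sets, finite partitions and ties *)

Section measure_lemmas.
Context d (T : measurableType d) (R : realType) (P : probability T R).

Lemma measure_eq_off_null (N A B : set T) :
  measurable N -> measurable A -> measurable B -> P N = 0%E ->
  A `\` N = B `\` N -> P A = P B.
Proof.
move=> mN mA mB PN AB.
have null (C : set T) : measurable C -> P (C `&` N) = 0%E.
  move=> mC; apply: (subset_measure0 _ _ _ PN) => //; exact: measurableI.
have split (C : set T) : measurable C -> P C = P (C `\` N).
  by move=> mC; rewrite (measureDI P mC mN) [X in (_ + X)%E]null// adde0.
by rewrite (split A)// AB -split.
Qed.

Lemma measure_fibers (K : finType) (f : T -> K) (A : set T) :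
  measurable A -> (forall k, measurable [set w | f w = k]) ->
  P A = (\sum_k P (A `&` [set w | f w = k]))%E.
Proof.
move=> mA mf.
have tf : trivIset setT (fun k => A `&` [set w | f w = k]).
  apply/trivIsetP => i j _ _ ij; apply/seteqP; split => w //= [[_ fi] [_ fj]].
  by move: ij; rewrite -fi fj eqxx.
rewrite fsbig_seq ?index_enum_uniq// -measure_fin_bigcup//; last 2 first.
- by apply: sub_trivIset tf.
- by move=> k _; exact: measurableI.
congr (P _); apply/seteqP; split=> [w Aw|w [k _ []]//].
by exists (f w) => //=; rewrite mem_index_enum.
Qed.

(** The joint law is the product of F with itself, and every section of the diagonal is a single
    point, hence null. *)
Lemma tie_null (F : probability R R) (X Y : T -> R) :
  (forall x, F [set x] = 0%E) ->
  measurable_fun setT X -> measurable_fun setT Y ->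
  (forall A B, measurable A -> measurable B ->
    P (X @^-1` A `&` Y @^-1` B) = (F A * F B)%E) ->
  P [set w | X w = Y w] = 0%E.
Proof.
move=> F1 mX mY indepXY.
pose D := [set p : R * R | p.1 = p.2].
have mD : measurable D.
  rewrite (_ : D = setT `&` [set p | p.1 == p.2]).
    exact: (measurable_fun_eqr measurable_fst measurable_snd).
  by rewrite setTI; apply/seteqP; split => p /= /eqP.
have mXY : measurable_fun setT (fun w => (X w, Y w)) by exact: measurable_fun_pair.
rewrite -[LHS]/(pushforward P (fun w => (X w, Y w)) D).
rewrite -(@product_measure_unique _ _ _ _ R F F)//.
  rewrite /product_measure1 /= integral0_eq// => x _.
  rewrite (_ : xsection D x = [set x])//.
  apply/seteqP; split => y; rewrite /xsection /= inE /D /=; by move=> ->.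
Qed.

End measure_lemmas.

(** * Nearest neighbor tours *)

Section tours.
Context (R : realType) (n : nat).
Local Notation city := 'I_n.+3.
Implicit Types (l : city -> city -> R) (v s : city -> city) (i j k m u : city).

(** Used both as the position right after the start of a tour and as a representative city other
    than city 1. *)
Definition second : city := Ordinal (isT : (1 < n.+3)%N).

Lemma second_neq0 : second <> ord0. Proof. by move=> /(congr1 val). Qed.

Lemma second_neq_last : second <> ord_max. Proof. by move=> /(congr1 val). Qed.

(** Independence is assumed for pairs with i < j only, so each edge is named by its ordered pair. *)
Definition edge i j : city * city := if (i < j)%N then (i, j) else (j, i).

Definition distances (x : city * city -> R) i j : R := x (edge i j).

Definition distinct_lengths l := forall p q : city * city,
  (p.1 < p.2)%N -> (q.1 < q.2)%N -> p <> q -> l p.1 p.2 <> l q.1 q.2.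

Lemma edge_lt i j : i <> j -> ((edge i j).1 < (edge i j).2)%N.
Proof.
move=> ij; rewrite /edge; case: (ltngtP i j) => //= e.
by case: ij; exact: val_inj.
Qed.

Lemma edge_inj i j k : edge i j = edge i k -> j = k.
Proof. by rewrite /edge; do 2 case: ifP => _; case=> // -> ->. Qed.

Lemma distinct_lengths_inj l i j k : (forall i j, l i j = l j i) ->
  distinct_lengths l -> i <> j -> i <> k -> l i j = l i k -> j = k.
Proof.
move=> lC dl ij ik.
have lE a b : l a b = l (edge a b).1 (edge a b).2 by rewrite /edge; case: ifP.
rewrite (lE i j) (lE i k) => e; apply: (@edge_inj i); apply: contrapT => ne.
exact: dl (edge_lt ij) (edge_lt ik) ne e.
Qed.

(** The inequality is strict, so at most one city other than city 1 qualifies. *)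
Definition nearest l k :=
  forall j, j <> ord0 -> j <> k -> l ord0 k < l ord0 j.

(* As s visits city 1 only at the start, this condition involves no edge at
   city 1. *)
Definition nn_from_second l s := forall i j, (0 < i)%N -> j = i.+1 :> nat ->
  forall u, (forall k, (k <= i)%N -> u <> s k) -> l (s i) (s j) <= l (s i) u.

Lemma nn_tour_inj l v : nn_tour l v -> injective v.
Proof.
move=> [_ nnv].
have neq i j : (i < j)%N -> v i <> v j.
  move=> ij e; have j0 : (j.-1 < n.+3)%N by rewrite (leq_ltn_trans (leq_pred _)).
  have jS : j = (Ordinal j0).+1 :> nat by rewrite /= prednK// (leq_trans _ ij).
  have [+ _] := nnv (Ordinal j0) j jS.
  by move=> /(_ i); apply; rewrite ?e// -ltnS -jS.
move=> i j e; apply: contrapT => ij.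
case: (ltngtP i j) => [/neq//|/neq/(_ (esym e))//|/val_inj//].
Qed.

(** Strong induction on the position: both tours minimize over the same unvisited cities, and
    distinct lengths leave one minimizer. The second city is prescribed, so s has to obey the
    nearest neighbor rule only from there on. *)
Lemma nn_tour_unique l v s : (forall i j, l i j = l j i) ->
  distinct_lengths l -> nn_tour l v ->
  s ord0 = ord0 -> injective s -> s second = v second -> nn_from_second l s ->
  s =1 v.
Proof.
move=> lC dl nnv s0 injs s1 nns i.
have injv := nn_tour_inj nnv; case: nnv => v0 nnv.
have [k] := ubnP (val i); elim: k i => // k IH i ik.
case: (posnP i) => [i0|igt0]; first by rewrite (_ : i = ord0) ?s0//; exact: val_inj.
have j0 : (i.-1 < n.+3)%N by rewrite (leq_ltn_trans (leq_pred _)).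
pose j : city := Ordinal j0; have iS : i = j.+1 :> nat by rewrite /= prednK.
case: (posnP j) => [jE0|jgt0].
  by rewrite (_ : i = second)//; apply: val_inj => /=; rewrite iS jE0.
have sv (a : city) : (a <= j)%N -> s a = v a.
  by move=> aj; apply: IH; rewrite (leq_ltn_trans aj)// -iS.
have inj_neq (f : city -> city) (a : city) : injective f -> (a <= j)%N -> f i <> f a.
  by move=> injf aj /injf/(congr1 val)/= ia; move: aj; rewrite -ia iS ltnn.
have [_ vle] := nnv j i iS.
(* Both tours have visited the same cities so far, so the next city of each is admissible for the
   other. *)
have {}vle : l (v j) (v i) <= l (v j) (s i).
  by apply: vle => a aj; rewrite -sv//; exact: inj_neq.
have sle : l (s j) (s i) <= l (s j) (v i).
  by apply: nns => // a aj; rewrite sv//; exact: inj_neq.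
move: sle; rewrite (sv j)// => sle.
apply: (distinct_lengths_inj lC dl (i := v j)).
- by rewrite -(sv j)// => /esym; exact: inj_neq.
- by move=> /esym; exact: inj_neq.
- by apply/le_anti/andP.
Qed.

Lemma second_nearest l v k : (forall i j, l i j = l j i) ->
  distinct_lengths l -> nn_tour l v -> k <> ord0 ->
  (v second = k <-> nearest l k).
Proof.
move=> lC dl nnv k0; have injv := nn_tour_inj nnv; case: nnv => v0 nnv.
have [_ vmin] := nnv ord0 second erefl.
have {}vmin u : u <> ord0 -> l ord0 (v second) <= l ord0 u.
  by move=> u0; rewrite -{1 2}v0; apply: vmin => i; rewrite leqn0 => /eqP i0;
    rewrite (_ : i = ord0) ?v0//; exact: val_inj.
have v10 : v second <> ord0 by rewrite -v0 => /injv/second_neq0.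
split=> [<- j j0 jv|kmin].
  rewrite lt_neqAle vmin// andbT; apply/eqP => /(distinct_lengths_inj lC dl) e.
  by apply: jv; rewrite e//; exact/nesym.
apply: contrapT => vk; have := kmin _ v10 vk.
by rewrite ltNge vmin.
Qed.

(* Outside ties, the event on the edges away from city 1 under which the nearest
   neighbor tour with second city k has last city m. *)
Definition tour_between k m : set (city * city -> R) :=
  [set x | exists s : {ffun city -> city},
    [/\ s ord0 = ord0, injective s, s second = k, s ord_max = m &
        nn_from_second (distances x) s]].

(** Separates the tour event into a condition on the star and one off the star: the star alone
    decides the second city, and from there on uniqueness identifies v with the witness s. *)
Lemma second_last_iff (x : city * city -> R) v k m :
  distinct_lengths (distances x) -> nn_tour (distances x) v -> k <> ord0 ->
  (v second = k /\ v ord_max = m) <->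
  (nearest (distances x) k /\ tour_between k m x).
Proof.
set l := distances x => dl nnv k0.
have lC i j : l i j = l j i.
  by rewrite /l /distances /edge; case: ltngtP => // /val_inj ->.
rewrite -(second_nearest lC dl nnv k0); split=> [[vk vm]|[vk [s [s0 injs s1 sm nns]]]].
  split=> //; exists (finfun v); split; rewrite ?ffunE//.
  - by case: nnv.
  - by move=> i j; rewrite !ffunE => /(nn_tour_inj nnv).
  - move=> i j i0 ij u uv; rewrite !ffunE.
    case: nnv => _ /(_ i j ij)[_]; apply => a ai; rewrite -(ffunE v); exact: uv.
split=> //; rewrite -sm; apply/esym/(nn_tour_unique lC dl nnv) => //.
by rewrite s1.
Qed.

Lemma Lfirst_second l v : nn_tour l v -> Lfirst l = l ord0 (v second).
Proof.
move=> nnv; have injv := nn_tour_inj nnv; case: nnv => v0 nnv.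
have [_ vmin] := nnv ord0 second erefl.
have v10 : (0 < v second)%N.
  rewrite lt0n; apply/eqP => v10; apply: second_neq0; apply: injv.
  by rewrite v0; exact: val_inj.
apply/le_anti/andP; split; first exact: bigmin_le_cond.
have {}vmin u : (0 < u)%N -> l ord0 (v second) <= l ord0 u.
  move=> u0; rewrite -{1 2}v0; apply: vmin => i; rewrite leqn0 => /eqP i0.
  rewrite (_ : i = ord0) ?v0; last exact: val_inj.
  by move=> u0'; rewrite u0' in u0.
apply: le_bigmin => [|i i0]; exact: vmin.
Qed.

End tours.

(** * Measurability of the tour events *)

Section measurable_comparisons.
Context d (T : measurableType d) (R : realType).

Lemma measurable_ler_set (f g : T -> R) :
  measurable_fun setT f -> measurable_fun setT g ->
  measurable [set x | f x <= g x].
Proof.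
move=> mf mg; rewrite -[X in measurable X]setTI.
exact: (measurable_fun_ler mf mg measurableT (Y := [set true])).
Qed.

Lemma measurable_ltr_set (f g : T -> R) :
  measurable_fun setT f -> measurable_fun setT g ->
  measurable [set x | f x < g x].
Proof.
move=> mf mg; rewrite -[X in measurable X]setTI.
exact: (measurable_fun_ltr mf mg measurableT (Y := [set true])).
Qed.

Lemma measurable_bigmin (J : Type) (r : seq J) (p : pred J) (f0 : T -> R)
    (f : J -> T -> R) :
  measurable_fun setT f0 -> (forall j, p j -> measurable_fun setT (f j)) ->
  measurable_fun setT (fun x => \big[Num.min/f0 x]_(j <- r | p j) f j x).
Proof.
move=> mf0 mf; elim: r => [|j r IHr].
  by under eq_fun do rewrite big_nil.
under eq_fun do rewrite big_cons.
case: (boolP (p j)) => // pj.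
by apply: measurable_minr => //; exact: mf.
Qed.

End measurable_comparisons.

Section events.
Context (R : realType) (n : nat).
Local Notation city := 'I_n.+3.
Implicit Types (i j k m u : city).

Definition star_edges : {set city * city} :=
  [set p : city * city | (p.1 == ord0) && (p.1 < p.2)%N].

Definition other_edges : {set city * city} :=
  [set p : city * city | (0 < p.1)%N && (p.1 < p.2)%N].

Lemma edge0 j : edge ord0 j = (ord0, j).
Proof.
rewrite /edge; case: ifPn => //; rewrite -leqNgt leqn0 => /eqP j0.
by have -> : j = ord0 by exact: val_inj.
Qed.

Lemma mem_star_edges j : j <> ord0 -> (ord0, j) \in star_edges.
Proof.
by move=> j0; rewrite inE /= lt0n; apply/eqP => j0'; apply: j0; exact: val_inj.
Qed.

Lemma mem_other_edges i j : i <> ord0 -> j <> ord0 -> i <> j ->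
  edge i j \in other_edges.
Proof.
move=> i0 j0 ij; rewrite inE edge_lt// andbT.
by rewrite /edge; case: ifP => _ /=; rewrite lt0n; apply/eqP => e;
  [apply: i0|apply: j0]; exact: val_inj.
Qed.

(** The star part of a tour event: when the tour starts with k and ends with m, the pair tested by
    [D] is the first and last edge length. *)
Definition nearest_event k m (D : set (R * R)) : set (city * city -> R) :=
  [set x | nearest (distances x) k /\
           D (distances x ord0 k, distances x ord0 m)].

Lemma measurable_nearest_event k m D : k <> ord0 -> m <> ord0 ->
  measurable D -> <<s boxes star_edges >> (nearest_event k m D).
Proof.
move=> k0 m0 mD.
have mcoord j : j <> ord0 ->
    measurable_fun [set: cylinders R star_edges] (fun x => distances x ord0 j).
  move=> j0; rewrite /distances edge0; apply: measurable_coord.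
  exact: mem_star_edges.
rewrite -[<<s _ >> _]/(@measurable _ (cylinders R star_edges) _).
apply: measurableI.
  rewrite (_ : (fun _ => _) = \bigcap_(j in [set j : city | j <> ord0 /\ j <> k])
      [set x : cylinders R star_edges | distances x ord0 k < distances x ord0 j]).
    apply: fin_bigcap_measurable => [|j [j0 jk]]; first exact: finite_finset.
    by apply: measurable_ltr_set; exact: mcoord.
  apply/seteqP; split => x /= xk j; first by case=> j0 jk; exact: xk.
  by move=> j0 jk; exact: xk.
rewrite -[X in measurable X]setTI.
exact: (measurable_fun_pair (mcoord k k0) (mcoord m m0)).
Qed.

(** A finite union over s of finite intersections of comparisons. No compared edge touches city 1,
    because s is injective and takes that value only at the start. *)
Lemma measurable_tour_between k m :
  <<s @boxes R _ other_edges >> (tour_between k m).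
Proof.
rewrite -[<<s _ >> _]/(@measurable _ (cylinders R other_edges) _).
pose S := [set s : {ffun city -> city} |
  [/\ s ord0 = ord0, injective s, s (second n) = k & s ord_max = m]].
pose Q (s : {ffun city -> city}) := [set p : city * city * city |
  [/\ (0 < p.1.1)%N, p.1.2 = p.1.1.+1 :> nat &
     forall a : city, (a <= p.1.1)%N -> p.2 <> s a]].
rewrite (_ : tour_between k m = \bigcup_(s in S) \bigcap_(p in Q s)
   [set x : cylinders R other_edges |
     distances x (s p.1.1) (s p.1.2) <= distances x (s p.1.1) p.2]).
  apply: fin_bigcup_measurable => [|s [s0 injs _ _]].
    exact: finite_finset.
  apply: fin_bigcap_measurable => [|[[i j] u] [/= i0 ij us]].
    exact: finite_finset.
  have neq0 (a : city) : (0 < a)%N -> s a <> ord0.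
    by move=> + sa0; rewrite (injs _ _ (etrans sa0 (esym s0))).
  have si0 : s i <> ord0 by exact: neq0.
  have sj0 : s j <> ord0 by apply: neq0; rewrite ij.
  have u0 : u <> ord0 by rewrite -s0; exact: us.
  have sisj : s i <> s j by move=> /injs e; move: ij; rewrite -e => /n_Sn.
  have siu : s i <> u by apply/nesym/us.
  by apply: measurable_ler_set; apply: measurable_coord; exact: mem_other_edges.
apply/seteqP; split => [x [s [s0 injs s1 sm nns]]|x [s [s0 injs s1 sm] nns]].
  exists s => // -[[i j] u] [/= i0 ij us]; exact: nns.
exists s; split=> // i j i0 ij u us; exact: (nns (i, j, u)).
Qed.

Lemma measurable_middle_sum : measurable_fun [set: cylinders R other_edges]
  (fun x => middle_sum (distances x)).
Proof.
have mcoord i j : (0 < i)%N -> (i < j)%N ->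
    measurable_fun [set: cylinders R other_edges] (fun x => distances x i j).
  by move=> i0 ij; rewrite /distances /edge ij; apply: measurable_coord;
    rewrite inE i0.
(* The excluded indices are given the value 0: city 1 would read star edges and the last city the
   diagonal default, neither of which is a coordinate in [other_edges]. *)
rewrite (_ : (fun x => _) = fun x : cylinders R other_edges =>
    \sum_(i < n.+3) if (0 < i < n.+2)%N then min_later (distances x) i else 0).
  apply: measurable_sum => i.
  case: (boolP (0 < i < n.+2)%N) => [/andP[i0 iN]|_]; last first.
    exact: measurable_cst.
  by apply: measurable_bigmin => [|j ij]; exact: mcoord.
by apply/funext => x; rewrite /middle_sum big_mkcond.
Qed.

End events.

(** * First and last edge for a fixed number of cities *)

Lemma disjoint_star_other n : [disjoint star_edges n & other_edges n]%B.
Proof.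
rewrite -setI_eq0; apply/eqP/setP => p; rewrite !inE.
by case: eqP => //= ->; rewrite ltnn andbF.
Qed.

Section nearest_neighbor_tour.
Context (R : realType) (n : nat) d (T : measurableType d) (P : probability T R)
  (F : probability R R) (L : 'I_n.+3 -> 'I_n.+3 -> {RV P >-> R})
  (v : T -> 'I_n.+3 -> 'I_n.+3).
Local Notation city := 'I_n.+3.
Implicit Types (i j k m u : city).
Hypothesis F_atomless : forall x, F [set x] = 0%E.
Hypothesis L_iid : iid_distances F L.
Hypothesis v_meas : forall i k, measurable [set w | v w i = k].
Hypothesis v_nn : forall w, nn_tour (fun i j => L i j w) (v w).

Local Notation X := (fun (p : city * city) w => L p.1 p.2 w).
Local Notation dist w := (fun i j => L i j w).
Local Notation sample w := (fun p : city * city => L p.1 p.2 w).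
Local Notation pre E := [set w | E (sample w)].
Local Notation edges := [pred p : city * city | (p.1 < p.2)%N].

Let star_sub : {subset star_edges n <= edges}.
Proof. by move=> p; rewrite !inE => /andP[]. Qed.

Let other_sub : {subset other_edges n <= edges}.
Proof. by move=> p; rewrite !inE => /andP[]. Qed.

Lemma measurable_edge p : measurable_fun setT (X p).
Proof. exact: measurable_funP. Qed.

Lemma dist_sample w : dist w = distances (sample w).
Proof.
have [LC _ _] := L_iid; apply/funext => i; apply/funext => j.
by rewrite /distances /edge; case: ifP.
Qed.

Lemma edge_law p B : p \in edges -> measurable B -> P (X p @^-1` B) = F B.
Proof. by have [_ LF _] := L_iid; move=> pE /(LF _ _ pE) <-. Qed.

Lemma indep_edges : mutually_independent P edges X.
Proof. by have [] := L_iid. Qed.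

Definition ties : set T := [set w | ~ distinct_lengths (dist w)].

Let tie_pairs := [set pq : (city * city) * (city * city) |
  [/\ (pq.1.1 < pq.1.2)%N, (pq.2.1 < pq.2.2)%N & pq.1 <> pq.2]].

Let tiesE : ties = \bigcup_(pq in tie_pairs) [set w | X pq.1 w = X pq.2 w].
Proof.
apply/seteqP; split=> [w|w [[p q] [/= pE qE pq] e]]; last first.
  by move=> /(_ _ _ pE qE pq).
move=> nd; apply: contrapT => nt; apply: nd => p q pE qE pq e.
by apply: nt; exists (p, q).
Qed.

Let measurable_tie p q : measurable [set w | X p w = X q w].
Proof.
rewrite -[X in measurable X]setTI.
rewrite (_ : [set w | _] = (fun w => X p w == X q w) @^-1` [set true]).
  exact: (measurable_fun_eqr (measurable_edge p) (measurable_edge q)).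
by apply/seteqP; split => w /= /eqP.
Qed.

Lemma measurable_ties : measurable ties.
Proof.
by rewrite tiesE; apply: fin_bigcup_measurable.
Qed.

(** A union bound over the finitely many pairs of edges; two distinct edges are independent with an
    atomless law, so each term vanishes. *)
Lemma ties_null : P ties = 0%E.
Proof.
apply/eqP; rewrite -measure_le0.
apply: (@le_trans _ _
  (\sum_(pq \in tie_pairs) P [set w | X pq.1 w = X pq.2 w])%E).
  apply: content_sub_fsum => //; first exact: finite_finset.
  - exact: measurable_ties.
  - by rewrite tiesE.
rewrite fsbig1// => -[p q] [/= pE qE pq].
apply: (tie_null F_atomless (measurable_edge p) (measurable_edge q)).
move=> A B mA mB.
have pE' : p \in edges by [].
have qE' : q \in edges by [].
have qp : (q == p) = false by apply/eqP => e; apply: pq.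
have := @indep_edges [set p; q]%SET _ (fun r => if r == p then A else B).
rewrite (_ : \bigcap_(i in _) _ = X p @^-1` A `&` X q @^-1` B); last first.
  apply/seteqP; split => [w Xw|w [Xp Xq] r /=].
    split; first by have /= := Xw p; rewrite !inE !eqxx; exact.
    by have /= := Xw q; rewrite !inE qp eqxx orbT; exact.
  by rewrite !inE; case: eqP => [->//|_] /= /eqP ->.
move=> ->; last 2 first.
- by move=> r; rewrite !inE => /orP[]/eqP ->.
- by move=> r; case: ifP.
rewrite big_setU1/=; last by rewrite inE eq_sym qp.
by rewrite big_set1 eqxx qp !edge_law.
Qed.

Let X1 w := Lfirst (dist w).
Let X2 w := Llast (dist w) (v w).

Lemma measurable_Lfirst : measurable_fun setT X1.
Proof.
by apply: measurable_bigmin => [|j _]; exact: measurable_funP.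
Qed.

Lemma measurable_Llast : measurable_fun setT X2.
Proof.
move=> _ B mB; rewrite setTI.
rewrite (_ : _ @^-1` _ = \bigcup_(k in [set: city])
    ([set w | v w ord_max = k] `&` L k ord0 @^-1` B)).
  apply: fin_bigcup_measurable => [|k _]; first exact: finite_finset.
  by apply: measurableI => //; exact: measurable_funPTI.
apply/seteqP; split=> [w Bw|w [k _ [/= <-]]//].
by exists (v w ord_max).
Qed.

Lemma measurable_pre J E : <<s boxes J >> E -> measurable (pre E).
Proof. by move=> sE; exact: measurable_cylinder_preimage measurable_edge sE. Qed.

Lemma measurable_first_last D : measurable D ->
  measurable [set w | D (X1 w, X2 w)].
Proof.
move=> mD; rewrite -[X in measurable X]setTI.
exact: (measurable_fun_pair measurable_Lfirst measurable_Llast).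
Qed.

(** Outside ties, the cell is a star event intersected with an event on the other edges, and on it
    the first and last lengths are the star edges to k and m. Independence of the star then gives
    the product. *)
Lemma tour_cell (C : set (city * city -> R)) (D : set (R * R)) k m :
  <<s boxes (other_edges n) >> C -> measurable D -> k <> ord0 -> m <> ord0 ->
  P ((pre C `&` [set w | D (X1 w, X2 w)]) `&` [set w | v w (second n) = k]
     `&` [set w | v w ord_max = m]) =
  (P (pre (nearest_event k m D)) * P (pre C `&` pre (tour_between k m)))%E.
Proof.
move=> sC mD k0 m0.
have sE := measurable_nearest_event k0 m0 mD.
have sH := @measurable_tour_between R n k m.
have sCH : <<s boxes (other_edges n) >> (C `&` tour_between k m).
  rewrite -[<<s _ >> _]/(@measurable _ (cylinders R (other_edges n)) _).
  exact: measurableI.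
have indep := independent_cylinders measurable_edge indep_edges star_sub
  other_sub (disjoint_star_other n) sE sCH.
transitivity (P (pre (nearest_event k m D) `&` pre (C `&` tour_between k m))) => //.
apply: (measure_eq_off_null measurable_ties _ _ ties_null).
- by apply: measurableI => //; apply: measurableI => //; apply: measurableI;
    [exact: measurable_pre sC|exact: measurable_first_last].
- by apply: measurableI; [exact: measurable_pre sE|exact: measurable_pre sCH].
have X1E w : v w (second n) = k -> X1 w = distances (sample w) ord0 k.
  by move=> <-; rewrite /X1 (Lfirst_second (v_nn w)) -dist_sample.
have X2E w : v w ord_max = m -> X2 w = distances (sample w) ord0 m.
  by have [LC _ _] := L_iid; move=> <-; rewrite /X2 /Llast LC -dist_sample.
have iff w : ~ ties w -> (v w (second n) = k /\ v w ord_max = m) <->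
    (nearest (distances (sample w)) k /\ tour_between k m (sample w)).
  rewrite /ties /= dist_sample => /contrapT nt; apply: second_last_iff => //.
  by rewrite -dist_sample; exact: v_nn.
apply/seteqP; split => w /=.
  move=> [[[[Cw Dw] vk] vm] nt]; split=> //.
  have [nk tw] := (iff w nt).1 (conj vk vm).
  by rewrite /nearest_event /= -(X1E w vk) -(X2E w vm).
move=> [[[nk Dw] [Cw tw]] nt]; split=> //.
have [vk vm] := (iff w nt).2 (conj nk tw).
by rewrite (X1E w vk) (X2E w vm).
Qed.

(** A permutation of the cities that fixes city 1 and maps (k, m) to (k', m') permutes the star
    edges, which are exchangeable. *)
Lemma nearest_event_exchangeable (D : set (R * R)) k m k' m' : measurable D ->
  k <> ord0 -> m <> ord0 -> k <> m -> k' <> ord0 -> m' <> ord0 -> k' <> m' ->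
  P (pre (nearest_event k m D)) = P (pre (nearest_event k' m' D)).
Proof.
move=> mD k0 m0 km k'0 m'0 k'm'.
(* The first transposition sends k to k', the second sends the image of m to m'; the second fixes
   k', since k' is neither m' nor the image of m. *)
pose s := (tperm k k' * tperm (tperm k k' m) m')%g.
have s0 : s ord0 = ord0.
  have t0 a b : a <> ord0 -> b <> ord0 -> tperm a b ord0 = ord0.
    by move=> a0 b0; rewrite tpermD//; apply/eqP.
  rewrite permM t0// t0// => /(congr1 (tperm k k')).
  by rewrite tpermK t0.
have sk : s k = k'.
  rewrite permM tpermL tpermD//; apply/eqP => //; last exact/nesym.
  move=> /(congr1 (tperm k k')); rewrite tpermK tpermR; exact/nesym.
have sm : s m = m' by rewrite permM tpermL.
pose f (p : city * city) := (s p.1, s p.2).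
have finj : {in star_edges n &, injective f}.
  by move=> [a b] [a' b'] _ _ [/perm_inj -> /perm_inj ->].
have fD : {in star_edges n, forall p, f p \in edges}.
  move=> [a b]; rewrite !inE /= => /andP[/eqP -> b0]; rewrite s0 lt0n.
  apply/eqP => sb; suff b0' : b = ord0 by rewrite b0' in b0.
  by apply: (@perm_inj _ s); rewrite s0; exact: val_inj.
rewrite -(exchangeable_cylinders measurable_edge indep_edges star_sub finj fD
  edge_law (measurable_nearest_event k0 m0 mD)).
congr (P _); apply/seteqP; split => w;
  rewrite /nearest_event /nearest /distances /=;
  rewrite !edge0/= !s0 !sk !sm => -[nk Dw]; split=> // j j0 jk.
- have := nk (s^-1%g j); rewrite !edge0 /= s0 permKV; apply.
    by move=> /(congr1 s); rewrite permKV s0.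
  by move=> /(congr1 s); rewrite permKV sk.
- rewrite !edge0/= s0; have := nk (s j); rewrite !edge0 /=; apply.
    by move=> sj; apply: j0; apply: (@perm_inj _ s); rewrite s0.
  by rewrite -sk => /perm_inj.
Qed.

(** The common value over all admissible pairs (k, m), read off at one fixed pair. *)
Let prob_nearest (D : set (R * R)) : \bar R :=
  P (pre (nearest_event (second n) ord_max D)).

Let last_neq0 : (ord_max : city) <> ord0. Proof. by move=> /(congr1 val). Qed.

Let measurable_nearest k : k <> ord0 ->
  measurable [set w | nearest (dist w) k].
Proof.
move=> k0; have := measurable_pre (measurable_nearest_event k0 k0 measurableT).
congr measurable; apply/seteqP; split => w /=; rewrite dist_sample.
  by case.
by split.
Qed.

Lemma measure_second A k : measurable A -> k <> ord0 ->
  P (A `&` [set w | v w (second n) = k]) =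
  P (A `&` [set w | nearest (dist w) k]).
Proof.
move=> mA k0; have mk := measurable_nearest k0.
apply: (measure_eq_off_null measurable_ties _ _ ties_null).
- exact: measurableI.
- exact: measurableI.
have [LC _ _] := L_iid.
have iff w : ~ ties w -> v w (second n) = k <-> nearest (dist w) k.
  by move=> /contrapT nt; apply: second_nearest.
apply/seteqP; split => w /= [[Aw vk] nt]; split=> //; split=> //; exact/(iff w nt).
Qed.

Lemma second_city_neq0 w : v w (second n) <> ord0.
Proof.
have [v0 _] := v_nn w => v10; apply: (@second_neq0 n).
by apply: (nn_tour_inj (v_nn w)); rewrite v0.
Qed.

Lemma last_city_neq0 w : v w ord_max <> ord0.
Proof.
have [v0 _] := v_nn w => vn0; apply: last_neq0.
by apply: (nn_tour_inj (v_nn w)); rewrite v0.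
Qed.

Lemma last_neq_second w : v w ord_max <> v w (second n).
Proof. by move=> /(nn_tour_inj (v_nn w))/esym/second_neq_last. Qed.

Lemma measure_split_second A : measurable A ->
  P A = (\sum_(k | k != ord0) P (A `&` [set w | v w (second n) = k]))%E.
Proof.
move=> mA; rewrite (measure_fibers P (f := fun w => v w (second n)) mA)//.
rewrite [RHS]big_mkcond/=; apply: eq_bigr => k _; case: eqP => //= ->.
rewrite (_ : _ `&` _ = set0) ?measure0//; apply/seteqP; split => w //= -[_].
exact: second_city_neq0.
Qed.

Lemma measure_split_last A k : measurable A ->
  P (A `&` [set w | v w (second n) = k]) =
  (\sum_(m | (m != ord0) && (m != k))
    P (A `&` [set w | v w (second n) = k] `&` [set w | v w ord_max = m]))%E.
Proof.
move=> mA; rewrite (measure_fibers P (f := fun w => v w ord_max))//; last first.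
  exact: measurableI.
rewrite [RHS]big_mkcond/=; apply: eq_bigr => m _; case: ifPn => //.
rewrite negb_and !negbK => /orP mE.
rewrite (_ : _ `&` _ = set0) ?measure0//.
apply/seteqP; split => w //= [[_ vk] vm].
case: mE => /eqP mE; move: vm; rewrite mE; first exact: last_city_neq0.
by rewrite -vk; exact: last_neq_second.
Qed.

Lemma prob_nearestE k m D : measurable D -> k <> ord0 -> m <> ord0 -> k <> m ->
  P (pre (nearest_event k m D)) = prob_nearest D.
Proof.
by move=> mD k0 m0 km; apply: nearest_event_exchangeable.
Qed.

Lemma measure_second_indep C k : <<s boxes (other_edges n) >> C -> k <> ord0 ->
  P (pre C `&` [set w | v w (second n) = k]) =
  (prob_nearest setT * P (pre C))%E.
Proof.
move=> sC k0; rewrite measure_second//; last exact: measurable_pre sC.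
(* [prob_nearestE] asks for a pair of distinct cities; with at least three cities, a partner m for k
   exists. *)
have [m [m0 km]] : exists m, m <> ord0 /\ k <> m.
  have [->|ke] := pselect (k = second n).
    by exists ord_max; split => //; exact: second_neq_last.
  by exists (second n); split => //; exact: second_neq0.
rewrite -(prob_nearestE measurableT k0 m0 km) setIC.
rewrite -(independent_cylinders measurable_edge indep_edges star_sub
  other_sub (disjoint_star_other n)
  (measurable_nearest_event k0 m0 measurableT) sC).
congr (P (_ `&` _)); apply/seteqP; split => w /=; rewrite dist_sample//.
by case.
Qed.

Lemma prob_nearest_fin_num D : measurable D -> prob_nearest D \is a fin_num.
Proof.
move=> mD; apply: fin_num_measure; apply: measurable_pre.
by apply: measurable_nearest_event => //; exact: second_neq0.
Qed.

Let sT : <<s @boxes R _ (other_edges n) >> setT.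
Proof. by apply: sub_sigma_algebra; exact: boxes_setT. Qed.

(** Otherwise every city would have probability 0 of being second, and these probabilities add up to
    1. *)
Lemma prob_nearestT_neq0 : prob_nearest setT != 0%E.
Proof.
apply/eqP => q0; have := probability_setT P.
rewrite (measure_split_second measurableT) big1 => [/eqP|k /eqP k0].
  by rewrite lt_eqF.
by rewrite -[setT]/(pre setT) measure_second_indep// q0 mul0e.
Qed.

(* Instead of constructing a tour with a given second city k, cancel the positive
   probability that k is the second city. *)
Lemma sum_tour_between C k : <<s boxes (other_edges n) >> C -> k <> ord0 ->
  (\sum_(m | (m != ord0) && (m != k)) P (pre C `&` pre (tour_between k m)))%E
    = P (pre C).
Proof.
move=> sC k0; have mC := measurable_pre sC.
(* The event C with second city k is evaluated twice, directly and as a sum over last cities; both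
   expressions carry the factor [prob_nearest setT]. *)
have := measure_split_last k mC; rewrite measure_second_indep//.
have -> : (\sum_(m | (m != ord0) && (m != k))
    P (pre C `&` [set w | v w (second n) = k] `&` [set w | v w ord_max = m]) =
  \sum_(m | (m != ord0) && (m != k))
    prob_nearest setT * P (pre C `&` pre (tour_between k m)))%E.
  apply: eq_bigr => m /andP[/eqP m0 /eqP/nesym km].
  rewrite -(prob_nearestE measurableT k0 m0 km) -tour_cell//.
  by rewrite setIT.
rewrite -ge0_sume_distrr//.
have q_gt0 : (0 < prob_nearest setT)%E.
  by rewrite lt_neqAle eq_sym prob_nearestT_neq0 measure_ge0.
have qE := lee_pmul2l (prob_nearest_fin_num measurableT) q_gt0.
by move=> e; apply/le_anti/andP; split; rewrite -qE e.
Qed.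

(** In the sum over cells the star factor is the same for all (k, m); the other factors add up over
    m to the probability of C, and there are [n.+2] choices of k. *)
Lemma measure_first_last_indep C D :
  <<s boxes (other_edges n) >> C -> measurable D ->
  P (pre C `&` [set w | D (X1 w, X2 w)]) =
  (n.+2%:R%:E * prob_nearest D * P (pre C))%E.
Proof.
move=> sC mD; have mC := measurable_pre sC.
have mXD := measurable_first_last mD.
rewrite measure_split_second; last exact: measurableI.
transitivity (\sum_(k : city | k != ord0) (prob_nearest D * P (pre C)))%E.
  apply: eq_bigr => k /eqP k0; rewrite measure_split_last; last exact: measurableI.
  rewrite -(sum_tour_between sC k0) ge0_sume_distrr//.
  apply: eq_bigr => m /andP[/eqP m0 /eqP/nesym km].
  by rewrite tour_cell// prob_nearestE.
by rewrite -muleA mule_natl sumr_const cardC1 card_ord.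
Qed.

Lemma measure_first_last D : measurable D ->
  P [set w | D (X1 w, X2 w)] = (n.+2%:R%:E * prob_nearest D)%E.
Proof.
move=> mD; rewrite -[LHS]/(P [set w | D (X1 w, X2 w)]) -(setTI [set w | _]).
rewrite -[setT]/(pre setT) measure_first_last_indep//.
by rewrite [X in (_ * X)%E](probability_setT P) mule1.
Qed.

Lemma middle_sum_indep :
  independent_pair P (fun w => middle_sum (dist w)) (fun w => X1 w + X2 w).
Proof.
move=> A B mA mB.
pose C := [set x : city * city -> R | A (middle_sum (distances x))].
have sC : <<s boxes (other_edges n) >> C.
  rewrite -[<<s _ >> _]/(@measurable _ (cylinders R (other_edges n)) _).
  by rewrite -[X in measurable X]setTI; exact: (measurable_middle_sum measurableT mA).
pose D := [set p : R * R | B (p.1 + p.2)].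
have mD : measurable D.
  rewrite -[X in measurable X]setTI.
  exact: (measurable_funD measurable_fst measurable_snd measurableT mB).
have -> : (fun w => middle_sum (dist w)) @^-1` A = pre C.
  by apply/seteqP; split => w; rewrite /C /= dist_sample.
rewrite -[X in P (_ `&` X)]/[set w | D (X1 w, X2 w)].
rewrite -[X in (_ * P X)%E]/[set w | D (X1 w, X2 w)].
by rewrite measure_first_last_indep// measure_first_last// muleC.
Qed.

Let measurable_fst_preimage (B : set R) : measurable B ->
  measurable [set p : R * R | B p.1].
Proof.
by move=> mB; rewrite -[X in measurable X]setTI; exact: measurable_fst.
Qed.

Let measurable_snd_preimage (B : set R) : measurable B ->
  measurable [set p : R * R | B p.2].
Proof.
by move=> mB; rewrite -[X in measurable X]setTI; exact: measurable_snd.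
Qed.

(* Condition on whether the second city is the far end of a given edge at
   city 1. *)
Lemma law_split B : measurable B ->
  F B = (n.+1%:R%:E * prob_nearest [set p | B p.2] +
         prob_nearest [set p | B p.1])%E.
Proof.
move=> mB; pose m := second n.
have m0 : m <> ord0 by exact: second_neq0.
have m_edge : (ord0, m) \in edges by [].
have mLB : measurable (X (ord0, m) @^-1` B) by exact: measurable_funPTI.
have mB1 := measurable_fst_preimage mB.
have mB2 := measurable_snd_preimage mB.
(* If m itself is second, its star edge is the first coordinate of the pair; for each of the [n.+1]
   other second cities k it is the second coordinate, as if m were the last city. *)
rewrite -(edge_law m_edge mB) measure_split_second// (bigD1 m)/=; last exact/eqP.
rewrite addeC; congr (_ + _)%E; last first.
  rewrite measure_second//; congr (P _); apply/seteqP; split => w /=.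
    by rewrite /nearest_event /= -dist_sample => -[].
  by rewrite /nearest_event /= -dist_sample => -[].
transitivity (\sum_(k : city | (k != ord0) && (k != m))
    prob_nearest [set p | B p.2])%E.
  apply: eq_bigr => k /andP[/eqP k0 /eqP km].
  rewrite -(prob_nearestE mB2 k0 m0 km) measure_second//.
  congr (P _); apply/seteqP; split => w /=;
    by rewrite /nearest_event /= -dist_sample => -[].
rewrite mule_natl sumr_const; congr (_ *+ _)%E.
rewrite (eq_card (B := [predC [set ord0; m]%SET])).
  by have := cardC [set ord0; m]%SET; rewrite card_ord cards2 /= => -[].
by move=> k; rewrite !inE negb_or.
Qed.

(** Multiplying [law_split] by [n.+2] turns its two terms into the laws of the last and the first
    edge. *)
Lemma first_last_laws B : measurable B ->
  (n.+1%:R%:E * P (X2 @^-1` B) + P (X1 @^-1` B) = n.+2%:R%:E * F B)%E.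
Proof.
move=> mB.
have mB1 := measurable_fst_preimage mB.
have mB2 := measurable_snd_preimage mB.
have := measure_first_last mB1; have := measure_first_last mB2.
rewrite /= => -> ->; rewrite (law_split mB) ge0_muleDr; [|exact: mule_ge0|by []].
by rewrite !muleA (muleC n.+1%:R%:E).
Qed.

(** * Moment and tail estimates for nonnegative distances *)

Hypothesis F_nonneg : F `[0%R, +oo[%classic = 1%E.

Let F_neg : F `]-oo, 0%R[%classic = 0%E.
Proof.
rewrite -setCitvr probability_setC// F_nonneg.
by rewrite subee.
Qed.

Let measurable_negative : measurable [set w | ~ (0 <= X1 w /\ 0 <= X2 w)].
Proof.
apply: measurableC; apply: measurableI.
- by apply: measurable_ler_set => //; exact: measurable_Lfirst.
- by apply: measurable_ler_set => //; exact: measurable_Llast.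
Qed.

(** Applied to the negative half-line, [first_last_laws] has right side 0, so both nonnegative terms
    on the left vanish. *)
Lemma Lfirst_Llast_ge0 : P [set w | ~ (0 <= X1 w /\ 0 <= X2 w)] = 0%E.
Proof.
have /eqP := first_last_laws (measurable_itv `]-oo, 0%R[).
rewrite F_neg mule0 padde_eq0//; last exact: mule_ge0.
rewrite mule_eq0 => /andP[/orP[|/eqP n2]].
  by rewrite eqe pnatr_eq0.
move=> /eqP n1.
have m1 : measurable (X1 @^-1` `]-oo, 0%R[%classic).
  by rewrite -[X in measurable X]setTI; exact: measurable_Lfirst.
have m2 : measurable (X2 @^-1` `]-oo, 0%R[%classic).
  by rewrite -[X in measurable X]setTI; exact: measurable_Llast.
rewrite (_ : [set w | _] =
  X1 @^-1` `]-oo, 0%R[%classic `|` X2 @^-1` `]-oo, 0%R[%classic).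
  by rewrite measureU0.
apply/seteqP; split => w /=; rewrite !in_itv/= !ltNge.
  by move=> /not_andP[]/negP ?; [left|right].
by case=> /negP n0 [? ?]; apply: n0.
Qed.

(** [first_last_laws] is an identity between measures on the line; here it is integrated against
    h. *)
Lemma Lfirst_Llast_integral (h : R -> \bar R) :
  measurable_fun setT h -> (forall x, (0 <= h x)%E) ->
  (n.+1%:R%:E * \int[P]_w h (X2 w) + \int[P]_w h (X1 w) =
   n.+2%:R%:E * \int[F]_x h x)%E.
Proof.
move=> mh h0.
have c0 (k : nat) : 0 <= k%:R :> R by exact: ler0n.
have /= <- := @ge0_integral_mscale _ _ R F setT measurableT (NngNum (c0 n.+2)) h
  mh (fun x _ => h0 x).
have mX1 := measurable_Lfirst; have mX2 := measurable_Llast.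
rewrite -[(\int[P]_w h (X1 w))%E]/(\int[P]_(w in X1 @^-1` setT) (h \o X1) w)%E.
rewrite -(ge0_integral_pushforward mX1)//.
rewrite -[(\int[P]_w h (X2 w))%E]/(\int[P]_(w in X2 @^-1` setT) (h \o X2) w)%E.
rewrite -(ge0_integral_pushforward mX2)//.
rewrite -[n.+1%:R%:E]/((NngNum (c0 n.+1))%:num%:E).
rewrite -ge0_integral_mscale// -ge0_integral_measure_add//.
apply: eq_measure_integral => A mA _.
rewrite [LHS]measure_addE; exact: first_last_laws.
Qed.

(** The edge to [second n] is left free: it serves as a sample from F independent of this event. *)
Let others_gt (e : R) : set T :=
  [set w | forall j, j <> ord0 -> j <> second n -> e < L ord0 j w].

Let measurable_others_gt e : measurable (others_gt e).
Proof.
rewrite (_ : others_gt e =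
    \bigcap_(j in [set j : city | j <> ord0 /\ j <> second n])
      [set w | e < L ord0 j w]).
  apply: fin_bigcap_measurable => [|j _]; first exact: finite_finset.
  by apply: measurable_ltr_set => //; exact: measurable_funP.
by apply/seteqP; split => w wj j; [case=> *; exact: wj|move=> *; exact: wj].
Qed.

(** The product rule over the whole star, with [B] at one edge and the tail at the remaining
    [n.+1]. *)
Lemma measure_others_gt e B : measurable B ->
  P (others_gt e `&` X (ord0, second n) @^-1` B) =
  ((fine (F `]e, +oo[%classic) ^+ n.+1)%:E * F B)%E.
Proof.
move=> mB; pose p0 : city * city := (ord0, second n).
pose box p := if p == p0 then B else `]e, +oo[%classic.
have mbox p : measurable (box p) by rewrite /box; case: ifP.
have p0s : p0 \in star_edges n by apply: mem_star_edges; exact: second_neq0.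
have := indep_edges star_sub mbox.
rewrite (_ : \bigcap_(p in _) _ = others_gt e `&` X p0 @^-1` B); last first.
  apply/seteqP; split => [w wb|w [wo wB] [a b]].
    split=> [j j0 j1|].
      have jp0 : ((ord0, j) == p0) = false by apply/eqP => -[/j1].
      have := wb (ord0, j) (mem_star_edges j0).
      by rewrite /box jp0/= in_itv/= andbT.
    by have := wb p0 p0s; rewrite /box eqxx.
  rewrite /= inE /= /box => /andP[/eqP -> b0]; case: eqP => [[->]//|bp].
  rewrite /= in_itv/= andbT; apply: wo.
    by move=> b0'; rewrite b0' in b0.
  by move=> b1; apply: bp; rewrite b1.
move=> ->; rewrite (bigD1 p0)//= {1}/box eqxx.
rewrite (edge_law (star_sub p0s) mB) muleC.
congr (_ * _)%E.
transitivity (\prod_(p in star_edges n :\ p0) (fine (F `]e, +oo[%classic))%:E)%E.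
  apply: eq_big => [p|p /andP[ps pp0]]; first by rewrite !inE andbC.
  by rewrite /box (negbTE pp0) edge_law ?fineK ?fin_num_measure// star_sub.
have card_star : #|star_edges n| = n.+2.
  rewrite (_ : star_edges n = [set (ord0, j) | j in [set~ ord0]]%SET).
    by rewrite card_imset ?cardsC1 ?card_ord// => i j [].
  apply/setP => -[a b]; rewrite inE /=; apply/andP/imsetP => [[/eqP -> b0]|[j]].
    by exists b => //; rewrite !inE; apply/eqP => b0'; rewrite b0' in b0.
  by rewrite !inE => j0 [-> ->]; rewrite lt0n.
rewrite prodEFin prodr_const; congr (_ ^+ _)%:E.
by have := cardsD1 p0 (star_edges n); rewrite p0s card_star => -[].
Qed.

Lemma Lfirst_gt e : (P [set w | (e < X1 w)%R] <=
  (fine (F `]e, +oo[%classic) ^+ n.+1)%:E)%E.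
Proof.
apply: (@le_trans _ _ (P (others_gt e `&` X (ord0, second n) @^-1` setT))).
  apply: le_measure; rewrite ?inE.
  - by apply: measurable_ltr_set => //; exact: measurable_Lfirst.
  - by apply: measurableI => //; exact: measurable_funPTI.
  - move=> w ew; split=> // j j0 _; apply: (lt_le_trans ew).
    apply: bigmin_le_cond; rewrite lt0n; apply/eqP => jE.
    by apply: j0; exact: val_inj.
by rewrite measure_others_gt// probability_setT mule1.
Qed.

(* Almost surely X1 <= Y, where Y is the length of the edge (1, 2) if all other
   edges at city 1 are longer than e, and Y = e otherwise. *)
Lemma Lfirst_sq_integral e : 0 <= e ->
  (\int[P]_w (X1 w ^+ 2)%:E <= (e ^+ 2)%:E +
   (fine (F `]e, +oo[%classic) ^+ n.+1)%:E * \int[F]_x (x ^+ 2)%:E)%E.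
Proof.
move=> e0; pose a := fine (F `]e, +oo[%classic) ^+ n.+1.
pose Y w := if w \in others_gt e then L ord0 (second n) w else e.
have mE (B : set R) : measurable [set _ : T | B e].
  by have [Be|nBe] := pselect (B e); [rewrite (_ : [set _ | _] = setT)|
    rewrite (_ : [set _ | _] = set0)] => //; apply/seteqP; split.
have mo := measurable_others_gt e.
have YE B : Y @^-1` B = (others_gt e `&` X (ord0, second n) @^-1` B) `|`
    (~` others_gt e `&` [set _ | B e]).
  apply/seteqP; split => w; rewrite /Y /=.
    by case: ifPn => [/set_mem ?|/negP wo] Bw; [left|right; split => // /mem_set].
  by move=> [[wo]|[wo]]; [rewrite mem_set|rewrite memNset].
have mYB B : measurable B -> measurable (Y @^-1` B).
  move=> mB; rewrite YE; apply: measurableU; apply: measurableI => //.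
    exact: measurable_funPTI.
  exact: measurableC.
have mY : measurable_fun setT Y by move=> _ B mB; rewrite setTI; exact: mYB.
have PA : P (others_gt e) = a%:E.
  have := measure_others_gt e measurableT.
  by rewrite probability_setT mule1 preimage_setT setIT.
have a0 : 0 <= a by rewrite exprn_ge0// fine_ge0.
have a1 : 0 <= 1 - a.
  by rewrite subr_ge0 -lee_fin -PA; exact: probability_le1.
(* On [others_gt e] the free edge still has law F, and elsewhere Y equals e; so the law of Y is a
   mixture of F and the point mass at e. *)
have PY B : measurable B ->
    P (Y @^-1` B) = (a%:E * F B + (1 - a)%:E * \d_e B)%E.
  move=> mB; rewrite YE measureU.
  - rewrite [X in (X + _ = _)%E]measure_others_gt//; congr (_ + _)%E.
    rewrite diracE.
    have [Be|nBe] := pselect (B e).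
      rewrite mem_set// mule1 (_ : [set _ | B e] = setT); last by apply/seteqP; split.
      by rewrite setIT [LHS](probability_setC P mo) PA.
    rewrite memNset// mule0 (_ : [set _ | B e] = set0) ?setI0 ?measure0//.
    by apply/seteqP; split.
  - by apply: measurableI => //; exact: measurable_funPTI.
  - by apply: measurableI => //; exact: measurableC.
  - by rewrite setIACA setICr set0I.
have msq : measurable_fun setT (fun x : R => (x ^+ 2)%:E).
  by apply/measurable_EFinP; exact: exprn_measurable.
have sq0 (x : R) : (0 <= (x ^+ 2)%:E)%E by rewrite lee_fin sqr_ge0.
apply: (@le_trans _ _ (\int[P]_w (Y w ^+ 2)%:E)%E).
  apply: ae_ge0_le_integral => //.
  - by apply: measurableT_comp msq _; exact: measurable_Lfirst.
  - exact: measurableT_comp msq _.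
  (* Squaring preserves X1 <= Y only for nonnegative lengths, so the null set of negative ones is
     discarded. *)
  - exists [set w | ~ (0 <= X1 w /\ 0 <= X2 w)]; split => //.
      exact: Lfirst_Llast_ge0.
    move=> w /= /not_implyP[_ nle] [X1_0 _]; apply: nle.
    suff X1Y : X1 w <= Y w.
      by rewrite lee_fin ler_sqr// nnegrE// (le_trans X1_0).
    rewrite /Y; case: ifPn => [_|/negP wo]; first exact: bigmin_le_cond.
    apply: contrapT => /negP; rewrite -ltNge => eX1; apply: wo; rewrite inE.
    move=> j j0 _; apply: lt_le_trans eX1 _; apply: bigmin_le_cond.
    by rewrite lt0n; apply/eqP => jE; apply: j0; exact: val_inj.
rewrite -[X in (X <= _)%E]/(
  \int[P]_(w in Y @^-1` setT) ((fun x : R => (x ^+ 2)%:E) \o Y) w)%E.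
rewrite -(ge0_integral_pushforward mY)//.
have -> : (\int[pushforward P Y]_x (x ^+ 2)%:E =
   \int[measure_add (mscale (NngNum a0) F) (mscale (NngNum a1) (\d_e))]_x
     (x ^+ 2)%:E)%E.
  apply: eq_measure_integral => A mA _.
  rewrite [RHS]measure_addE; exact: PY.
rewrite ge0_integral_measure_add// !ge0_integral_mscale//= integral_dirac//.
rewrite addeC; apply: leeD => //.
by rewrite diracT mul1e -EFinM lee_fin ler_piMl ?sqr_ge0// gerBl.
Qed.

Let ae_nonneg (Q : T -> Prop) :
  (forall w, 0 <= X1 w -> 0 <= X2 w -> Q w) -> {ae P, forall w, Q w}.
Proof.
move=> Q0; exists [set w | ~ (0 <= X1 w /\ 0 <= X2 w)]; split => //.
  exact: Lfirst_Llast_ge0.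
by move=> w /= nQ [? ?]; apply: nQ; exact: Q0.
Qed.

Let mX1 := measurable_Lfirst.
Let mX2 := measurable_Llast.
Let mX12 : measurable_fun setT (fun w => X1 w + X2 w).
Proof. exact: measurable_funD. Qed.

Let measurable_sq (f : T -> R) : measurable_fun setT f ->
  measurable_fun setT (fun w => (f w ^+ 2)%:E).
Proof. by move=> mf; apply/measurable_EFinP; exact: measurable_funX. Qed.

Let measurable_norm (f : T -> R) : measurable_fun setT f ->
  measurable_fun setT (fun w => `|f w|%:E).
Proof. by move=> mf; apply/measurable_EFinP; exact: measurableT_comp. Qed.

Let sq_ge0 (f : T -> R) w : (0 <= (f w ^+ 2)%:E)%E.
Proof. by rewrite lee_fin sqr_ge0. Qed.

Lemma first_last_sq_ge :
  (\int[P]_w (X2 w ^+ 2)%:E <= \int[P]_w ((X1 w + X2 w) ^+ 2)%:E)%E.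
Proof.
apply: ae_ge0_le_integral.
- by [].
- by move=> w _; rewrite lee_fin sqr_ge0.
- exact: measurable_sq.
- by move=> w _; rewrite lee_fin sqr_ge0.
- exact: measurable_sq mX12.
apply: ae_nonneg => w X1_0 X2_0 _.
by rewrite lee_fin ler_sqr ?nnegrE ?addr_ge0// lerDr.
Qed.

(** Young's inequality for the cross term. A small c leaves the last edge with a factor near 1 while
    the large factor falls on the vanishing first edge. *)
Lemma first_last_sq_le (c : R) : 0 < c ->
  (\int[P]_w ((X1 w + X2 w) ^+ 2)%:E <=
   (1 + c^-1)%:E * \int[P]_w (X1 w ^+ 2)%:E +
   (1 + c)%:E * \int[P]_w (X2 w ^+ 2)%:E)%E.
Proof.
move=> c0; have ci0 : 0 < c^-1 by rewrite invr_gt0.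
rewrite -ge0_integralZl//; [|exact: measurable_sq|by rewrite lee_fin addr_ge0// ltW].
rewrite -ge0_integralZl//; [|exact: measurable_sq|by rewrite lee_fin addr_ge0// ltW].
rewrite -ge0_integralD//; last 4 first.
- by move=> w _; rewrite mule_ge0// lee_fin addr_ge0// ltW.
- by apply: measurable_funeM; exact: measurable_sq.
- by move=> w _; rewrite mule_ge0// lee_fin addr_ge0// ltW.
- by apply: measurable_funeM; exact: measurable_sq.
apply: ge0_le_integral.
- by [].
- by move=> w _; rewrite lee_fin sqr_ge0.
- exact: measurable_sq mX12.
- by apply: emeasurable_funD; apply: measurable_funeM; exact: measurable_sq.
move=> w _; rewrite -!EFinM -EFinD lee_fin.
rewrite -subr_ge0 (_ : _ - _ = c^-1 * (X1 w - c * X2 w) ^+ 2).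
  by rewrite mulr_ge0 ?sqr_ge0// ltW.
by field; rewrite gt_eqF.
Qed.

(** Passing to absolute values alters the lengths on a null set only and makes the integral additive
    without integrability. *)
Lemma first_last_mean : (\int[P]_w (X1 w + X2 w)%:E =
  \int[P]_w `|X1 w|%:E + \int[P]_w `|X2 w|%:E)%E.
Proof.
rewrite -ge0_integralD//; [|exact: measurable_norm|exact: measurable_norm].
apply: ae_eq_integral => //.
- exact/measurable_EFinP.
- by apply: emeasurable_funD; exact: measurable_norm.
- by apply: ae_nonneg => w X1_0 X2_0 _; rewrite EFinD !ger0_norm.
Qed.

(** A pointwise bound of the absolute value by its square, through which convergence of the second
    moment to 0 passes to the mean. *)
Lemma Lfirst_mean_le (c : R) : 0 < c ->
  (\int[P]_w `|X1 w|%:E <= c%:E + c^-1%:E * \int[P]_w (X1 w ^+ 2)%:E)%E.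
Proof.
move=> c0; have ci0 : 0 < c^-1 by rewrite invr_gt0.
rewrite -ge0_integralZl//; [|exact: measurable_sq|by rewrite lee_fin ltW].
have -> : c%:E = (\int[P]_w (cst c%:E) w)%E.
  by rewrite integral_cst// [X in (_ * X)%E](probability_setT P) mule1.
rewrite -ge0_integralD//; last 3 first.
- by move=> w _; rewrite lee_fin ltW.
- by move=> w _; rewrite mule_ge0// lee_fin ltW.
- by apply: measurable_funeM; exact: measurable_sq.
apply: ge0_le_integral.
- by [].
- by move=> w _; rewrite lee_fin.
- exact: measurable_norm.
- by apply: emeasurable_funD => //; apply: measurable_funeM; exact: measurable_sq.
move=> w _; rewrite -!EFinM -EFinD lee_fin -[X1 w ^+ 2]real_normK ?num_real//.
rewrite -subr_ge0 (_ : _ - _ = c^-1 * ((c - `|X1 w|) ^+ 2 + c * `|X1 w|)).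
  by rewrite mulr_ge0 ?addr_ge0 ?sqr_ge0 ?mulr_ge0// ltW.
by field; rewrite gt_eqF.
Qed.

Let measurable_cdf (f : T -> R) x : measurable_fun setT f ->
  measurable (f @^-1` `]-oo, x]%classic).
Proof. by move=> mf; rewrite -[X in measurable X]setTI; exact: mf. Qed.

Lemma first_last_cdf_le x :
  (P ((fun w => (X1 w + X2 w)%R) @^-1` `]-oo, x]%classic) <=
   P (X2 @^-1` `]-oo, x]%classic))%E.
Proof.
set N := [set w | ~ (0 <= X1 w /\ 0 <= X2 w)].
have mC := measurable_cdf x mX2.
rewrite -[leRHS](measureU0 (B := N))//; last exact: Lfirst_Llast_ge0.
apply: le_measure; rewrite ?inE.
- exact: measurable_cdf.
- exact: measurableU.
move=> w /=; rewrite !in_itv/= => X12x.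
have [|nN] := pselect (N w); [by right|left].
by move/contrapT : nN => [X1_0 _]; rewrite (le_trans _ X12x)// lerDr.
Qed.

(** If the last edge is at most x - e, the sum can exceed x only when the first edge exceeds e. *)
Lemma first_last_cdf_ge x e :
  (P (X2 @^-1` `]-oo, (x - e)%R]%classic) <=
   P ((fun w => (X1 w + X2 w)%R) @^-1` `]-oo, x]%classic) +
   P [set w | (e < X1 w)%R])%E.
Proof.
have me : measurable [set w | e < X1 w] by exact: measurable_ltr_set.
have mF := measurable_cdf x mX12.
apply: le_trans (measureU2 P mF me); apply: le_measure; rewrite ?inE.
- exact: measurable_cdf.
- exact: measurableU.
move=> w /=; rewrite !in_itv/= => X2x.
have [X1e|?] := leP (X1 w) e; [left|by right].
by rewrite -(subrK e x) addrC lerD.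
Qed.

End nearest_neighbor_tour.

(** * Limits *)

Section nonnegative_law.
Context (R : realType) (F : probability R R) (mu sigma : R).
Hypothesis F_nonneg : F `[0%R, +oo[%classic = 1%E.
Hypothesis F_mean : ('E_F[idfun])%E = mu%:E.
Hypothesis F_variance : ('V_F[idfun])%E = (sigma ^+ 2)%:E.

Let ae_nonneg (Q : R -> Prop) :
  (forall x, 0 <= x -> Q x) -> {ae F, forall x, Q x}.
Proof.
move=> Q0; exists `]-oo, 0%R[%classic; split => //.
  by rewrite -setCitvr probability_setC// F_nonneg subee.
move=> x /= nQ; rewrite in_itv/= ltNge; apply/negP => x0; apply: nQ; exact: Q0.
Qed.

Lemma law_mean_norm : (\int[F]_x `|x|%:E)%E = mu%:E.
Proof.
rewrite -F_mean unlock; apply: ae_eq_integral => //.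
- by apply/measurable_EFinP; exact: normr_measurable.
- by apply/measurable_EFinP; exact: measurable_id.
- by apply: ae_nonneg => x x0 _; rewrite ger0_norm.
Qed.

(** The expanded square is arranged with nonnegative terms on both sides, using x = |x| almost
    everywhere, so that integrals add before the second moment is known to be finite. *)
Lemma law_second_moment : (\int[F]_x (x ^+ 2)%:E)%E = (mu ^+ 2 + sigma ^+ 2)%:E.
Proof.
have mu0 : 0 <= mu.
  by rewrite -lee_fin -law_mean_norm integral_ge0// => x _; rewrite lee_fin.
have var : (\int[F]_x ((x - mu) ^+ 2)%:E)%E = (sigma ^+ 2)%:E.
  by rewrite -F_variance /variance unlock F_mean unlock.
have msq (c : R) : measurable_fun setT (fun x : R => ((x - c) ^+ 2)%:E).
  apply/measurable_EFinP; apply: measurable_funX.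
  exact: measurable_funB.
have mn : measurable_fun setT (fun x : R => `|x|%:E).
  by apply/measurable_EFinP; exact: normr_measurable.
have msq0 : measurable_fun setT (fun x : R => (x ^+ 2)%:E).
  by apply/measurable_EFinP; exact: exprn_measurable.
have : (\int[F]_x ((x ^+ 2)%:E + (cst (mu ^+ 2)%:E) x) =
    \int[F]_x (((x - mu) ^+ 2)%:E + (2 * mu)%:E * `|x|%:E))%E.
  apply: ae_eq_integral => //.
  - exact: emeasurable_funD.
  - by apply: emeasurable_funD => //; exact: measurable_funeM.
  - apply: ae_nonneg => x x0 _; rewrite ger0_norm//= -EFinM -!EFinD.
    by congr (_%:E); ring.
rewrite ge0_integralD//; last 2 first.
- by move=> x _; rewrite lee_fin sqr_ge0.
- by move=> x _; rewrite lee_fin sqr_ge0.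
rewrite ge0_integralD//; last 3 first.
- by move=> x _; rewrite lee_fin sqr_ge0.
- by move=> x _; rewrite -EFinM lee_fin !mulr_ge0.
- exact: measurable_funeM.
rewrite var ge0_integralZl//; last by rewrite lee_fin mulr_ge0.
rewrite law_mean_norm integral_cst// [X in (_ * X)%E](probability_setT F) mule1.
(* The right side is finite, which excludes an infinite second moment; the rest is real
   arithmetic. *)
case: (\int[F]_x _)%E => [r [r_eq]|//|//].
by congr (_%:E); lra.
Qed.

Lemma law_tail_lt1 e : support_starts_at_0 F -> 0 < e ->
  fine (F `]e, +oo[%classic) < 1.
Proof.
move=> F0 e0; rewrite -lte_fin fineK ?fin_num_measure//.
rewrite -setCitvl probability_setC// lteBlDr ?fin_num_measure//.
rewrite -[X in (X < _)%E]adde0 lteD2lE//.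
apply: lt_le_trans (F0 e e0) _; apply: le_measure; rewrite ?inE//.
by move=> x /=; rewrite !in_itv/= => /andP[].
Qed.

(** The half-lines ending at x - 1/(k+1) increase to the open half-line below x, and the point x is
    null. *)
Lemma atomless_cdf_left (x eps : R) : (forall x, F [set x] = 0%E) -> 0 < eps ->
  exists2 e, 0 < e & (F `]-oo, x]%classic <= F `]-oo, (x - e)%R]%classic + eps%:E)%E.
Proof.
move=> F1 eps0.
pose I (k : nat) : set R := `]-oo, (x - k.+1%:R^-1)%R]%classic.
have UI : \bigcup_k I k = `]-oo, x[%classic.
  apply/seteqP; split => [y [k _]|y]; rewrite /I /= !in_itv/=.
    by move=> /le_lt_trans; apply; rewrite ltrBlDr ltrDl invr_gt0.
  move=> /ltr_add_invr[k yk]; exists k => //=.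
  by rewrite in_itv/= lerBrDr ltW.
have FxE : F `]-oo, x]%classic = F (\bigcup_k I k).
  rewrite UI (_ : `]-oo, x]%classic = `]-oo, x[%classic `|` [set x]); last first.
    by rewrite setUitv1.
  by rewrite measureU0//; exact: F1.
have : F (I k) @[k --> \oo] --> F (\bigcup_k I k).
  have mI k : measurable (I k) by exact: measurable_itv.
  have mU : measurable (\bigcup_k I k) by rewrite UI; exact: measurable_itv.
  apply: nondecreasing_cvg_mu; [exact: mI|exact: mU|].
  move=> m k mk; apply/subsetPset => y; rewrite /I /= !in_itv/= => /le_trans; apply.
  by rewrite lerD2l lerN2 lef_pV2 ?posrE// ler_nat.
rewrite -FxE -(fineK (fin_num_measure F _ (measurable_itv `]-oo, x]))).
move/fine_cvgP => [_ /cvgrPdist_le/(_ _ eps0)[k _ /(_ k (leqnn k)) /=]].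
rewrite ler_distlC => /andP[kx _]; exists k.+1%:R^-1; first by rewrite invr_gt0.
have fin y : F `]-oo, y]%classic \is a fin_num by exact: fin_num_measure.
by rewrite -(fineK (fin x)) -(fineK (fin (x - _))) -EFinD lee_fin -lerBlDr.
Qed.

End nonnegative_law.

(** * Limits of real sequences *)

Section real_limits.
Context (R : realType).
Implicit Types (a b u : nat -> R).

Lemma cvg0_geometric_bound a (S : R) : (forall n, 0 <= a n) ->
  (forall e, 0 < e -> exists2 c, 0 <= c < 1 &
     forall n, a n <= e ^+ 2 + c ^+ n.+1 * S) ->
  a @ \oo --> 0.
Proof.
move=> a0 aS; apply/cvgr0Pnorm_le => eps eps0.
(* The cap at 1 gives e^2 <= e <= eps / 2; the geometric term takes the other half. *)
pose e := Num.min 1 (eps / 2).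
have e0 : 0 < e by rewrite lt_min ltr01 divr_gt0.
have e1 : e <= 1 by rewrite /e ge_min lexx.
have e2 : e ^+ 2 <= eps / 2.
  rewrite (@le_trans _ _ e)//; first by rewrite expr2 ler_piMl// ltW.
  by rewrite /e ge_min lexx orbT.
have [c /andP[c0 c1] ac] := aS e e0.
have : geometric (c * S) c @ \oo --> 0 by apply: cvg_geometric; rewrite ger0_norm.
have eps2 : 0 < eps / 2 by rewrite divr_gt0.
move=> /cvgr0Pnorm_le/(_ _ eps2).
apply: filterS => n /= gn; rewrite (ger0_norm (a0 n)).
apply: le_trans (ac n) _; rewrite [leRHS](splitr eps) lerD//.
by rewrite exprS mulrAC (le_trans (ler_norm _)).
Qed.

(** Solving for b gives b n = s + (s - a n) / (n + 1), and a is bounded. *)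
Lemma cvg_weighted_mean a b (s K : R) : (forall n, 0 <= a n <= K) ->
  (forall n, n.+1%:R * b n + a n = n.+2%:R * s) -> b @ \oo --> s.
Proof.
move=> aK ab.
have bE n : b n = s + (s - a n) * harmonic n.
  have n0 : n.+1%:R != 0 :> R by [].
  apply: (mulfI n0); rewrite mulrDr mulrCA mulfV// mulr1.
  by move: (ab n); rewrite -[n.+2%:R]natr1; lra.
rewrite (_ : b = fun n => s + (s - a n) * harmonic n); last exact/funext.
rewrite -[X in _ --> X]addr0; apply: cvgD; first exact: cvg_cst.
have h0 : (fun n => (`|s| + K) * harmonic n) @ \oo --> 0.
  by rewrite -[X in _ --> X](mulr0 (`|s| + K)); apply: cvgMr; exact: cvg_harmonic.
apply/cvgr0Pnorm_le => eps eps0; move/cvgr0Pnorm_le : h0 => /(_ eps eps0).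
apply: filterS => n; apply: le_trans; rewrite !normrM ler_wpM2r//.
have /andP[a0 aK'] := aK n.
rewrite [leRHS]ger0_norm ?addr_ge0// ?(le_trans a0)//.
by rewrite (le_trans (ler_normB _ _))// lerD2l ger0_norm.
Qed.

Lemma cvg_perturbed_square a b u (s : R) : a @ \oo --> 0 -> b @ \oo --> s ->
  (forall n, b n <= u n) ->
  (forall c, 0 < c -> forall n, u n <= (1 + c^-1) * a n + (1 + c) * b n) ->
  u @ \oo --> s.
Proof.
move=> a0 bs bu uab; apply/cvgrPdist_le => eps eps0.
(* Chosen so that c * s <= eps / 2; the added 1 keeps the denominator positive when s = 0. *)
pose c := eps / (2 * (`|s| + 1)).
have s1 : 0 < `|s| + 1 by rewrite ltr_wpDl.
have c0 : 0 < c by rewrite divr_gt0// mulr_gt0.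
have cs : c * s <= eps / 2.
  rewrite (@le_trans _ _ (c * (`|s| + 1)))//.
    by rewrite ler_pM2l// (le_trans (ler_norm s))// lerDl.
  by rewrite /c invfM mulrA -mulrA mulVf ?mulr1// gt_eqF.
have ub : (fun n => (1 + c^-1) * a n + (1 + c) * b n) @ \oo --> (1 + c) * s.
  rewrite -[X in _ --> X]add0r -[X in _ --> X + _](mulr0 (1 + c^-1)).
  by apply: cvgD; apply: cvgMr.
have eps2 : 0 < eps / 2 by rewrite divr_gt0.
near=> n; rewrite ler_distlC; apply/andP; split.
  apply: le_trans (bu n).
  have : `|s - b n| <= eps by near: n; move/cvgrPdist_le : bs; apply.
  by rewrite ler_distlC => /andP[].
apply: le_trans (uab c c0 n) _.
have : `|(1 + c) * s - ((1 + c^-1) * a n + (1 + c) * b n)| <= eps / 2.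
  by near: n; move/cvgrPdist_le : ub; apply.
by rewrite ler_distlC => /andP[_]; move: cs; lra.
Unshelve. all: by end_near. Qed.

Lemma cvg0_square_bound a u : a @ \oo --> 0 -> (forall n, 0 <= u n) ->
  (forall c, 0 < c -> forall n, u n <= c + c^-1 * a n) -> u @ \oo --> 0.
Proof.
move=> a0 u0 ua; apply/cvgr0Pnorm_le => eps eps0.
have eps2 : 0 < eps / 2 by rewrite divr_gt0.
have /cvgr0Pnorm_le/(_ _ eps2) :
    (fun n => (eps / 2)^-1 * a n) @ \oo --> 0.
  by rewrite -[X in _ --> X](mulr0 (eps / 2)^-1); apply: cvgMr.
apply: filterS => n /(le_trans (ler_norm _)) an; rewrite (ger0_norm (u0 n)).
by apply: le_trans (ua _ eps2 n) _; move: an; lra.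
Qed.

End real_limits.

(** A finite total forces both summands to be finite, so the extended-real identities become real
    ones. *)
Lemma fine_weighted_sum (R : realType) (k z : R) (x y : \bar R) :
  0 < k -> (0 <= y)%E -> (k%:E * y + x = z%:E)%E ->
  [/\ x \is a fin_num, y \is a fin_num & k * fine y + fine x = z].
Proof.
move=> k0 y0 e; have : (k%:E * y + x)%E \is a fin_num by rewrite e.
rewrite fin_numD => /andP[kyf xf]; have yf : y \is a fin_num.
  rewrite ge0_fin_numE// ltey; apply/eqP => yoo; move: kyf.
  by rewrite yoo gt0_muley// lte_fin.
by split=> //; apply: EFin_inj; rewrite -e EFinD EFinM !fineK.
Qed.

(* Index n of the sequences stands for n.+3 cities, i.e. every number of cities
   that is at least 3. *)
Theorem proposition3p1 (R : realType) (F : probability R R) (mu sigma : R)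
  (F_nonneg : F `[0%R, +oo[%classic = 1%E)
  (F_density : has_density F)
  (F_mean : ('E_F[idfun])%E = mu%:E)
  (F_variance : ('V_F[idfun])%E = (sigma ^+ 2)%:E)
  (d : nat -> measure_display) (T : forall n : nat, measurableType (d n))
  (P : forall n : nat, probability (T n) R)
  (L : forall n : nat, 'I_n.+3 -> 'I_n.+3 -> {RV (P n) >-> R})
  (L_iid : forall n : nat, iid_distances F (L n))
  (v : forall n : nat, T n -> 'I_n.+3 -> 'I_n.+3)
  (v_meas : forall (n : nat) (i k : 'I_n.+3), measurable [set w | v n w i = k])
  (v_nn : forall (n : nat) (w : T n), nn_tour (fun i j => L n i j w) (v n w)) :
  let FL (n : nat) (w : T n) : R :=
    Lfirst (fun i j => L n i j w) + Llast (fun i j => L n i j w) (v n w) in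
  let M (n : nat) (w : T n) : R := middle_sum (fun i j => L n i j w) in
  [/\ support_starts_at_0 F ->
        forall x : R,
          P n (FL n @^-1` `]-oo, x]%classic) @[n --> \oo] -->
            F `]-oo, x]%classic,
      forall n : nat, independent_pair (P n) (M n) (FL n) &
      support_starts_at_0 F ->
        (('E_(P n)[FL n])%E @[n --> \oo] --> mu%:E) /\
        (('E_(P n)[fun w => (FL n w ^+ 2)%R])%E @[n --> \oo] -->
           (mu ^+ 2 + sigma ^+ 2)%:E)].
Proof.
move=> FL M.
have F1 x : F [set x] = 0%E by exact: has_density_set1.
pose X1 n w := Lfirst (fun i j => L n i j w).
pose X2 n w := Llast (fun i j => L n i j w) (v n w).
pose tail e := fine (F `]e, +oo[%classic).
have tail_ge0 e : 0 <= tail e by exact: fine_ge0.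
have mX1 n : measurable_fun setT (X1 n) by exact: measurable_Lfirst.
have mX2 n : measurable_fun setT (X2 n) by exact: measurable_Llast (v_meas n).
have mFL n : measurable_fun setT (FL n) by exact: measurable_funD.
have mle n (f : T n -> R) (mf : measurable_fun setT f) y :
    measurable (f @^-1` `]-oo, y]%classic).
  by rewrite -[X in measurable X]setTI; exact: mf.
split.
- move=> F0 x.
  pose q y n := fine (P n (X2 n @^-1` `]-oo, y]%classic)).
  pose p n := fine (P n (FL n @^-1` `]-oo, x]%classic)).
  have Pfin n A : measurable A -> P n A \is a fin_num by exact: fin_num_measure.
  (* With B a half-line, [first_last_laws] is a weighted mean of distribution functions whose
     first-edge term is bounded by 1. *)
  have qF y : q y @ \oo --> fine (F `]-oo, y]%classic).
    apply: (@cvg_weighted_mean R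
      (fun n => fine (P n (X1 n @^-1` `]-oo, y]%classic))) _ _ 1) => n.
      by rewrite fine_ge0//= -lee_fin fineK ?Pfin ?probability_le1//; exact: mle.
    have n1 : 0 < n.+1%:R :> R by [].
    have := first_last_laws F1 (L_iid n) (v_meas n) (v_nn n)
      (measurable_itv `]-oo, y]).
    rewrite -[F _]fineK ?fin_num_measure// -EFinM.
    by case/(fine_weighted_sum n1) => //.
  have pq n : p n <= q x n.
    rewrite -lee_fin !fineK ?Pfin//; [|exact: mle|exact: mle].
    exact: (first_last_cdf_le F1 (L_iid n) (v_meas n) (v_nn n) F_nonneg).
  have qp e n : q (x - e) n <= p n + tail e ^+ n.+1.
    rewrite -lee_fin EFinD !fineK ?Pfin//; [|exact: mle|exact: mle].
    apply: (le_trans (first_last_cdf_ge (L n) (v_meas n) x e)); apply: leeD => //.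
    exact: (Lfirst_gt (L_iid n)).
  suff pF : p @ \oo --> fine (F `]-oo, x]%classic).
    rewrite -[F _]fineK ?fin_num_measure//; apply/fine_cvgP; split=> //.
    by near=> n; apply: Pfin; exact: mle.
  (* [pq] gives the upper bound. The lower bound spends eps / 3 each on left continuity of F at x,
     on convergence of q at x - e, and on the tail of the first edge. *)
  apply/cvgrPdist_le => eps eps0.
  have eps3 : 0 < eps / 3 by rewrite divr_gt0.
  have [e e0] := atomless_cdf_left x F1 eps3.
  rewrite -[F _ in X in (X <= _)%E]fineK ?fin_num_measure//.
  rewrite -[F `]-oo, (x - e)%R]%classic]fineK ?fin_num_measure// -EFinD lee_fin => Fe.
  have tail0 : geometric (tail e) (tail e) @ \oo --> 0.
    by apply: cvg_geometric; rewrite ger0_norm// law_tail_lt1.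
  near=> n.
  have : `|fine (F `]-oo, x]%classic) - q x n| <= eps / 3.
    by near: n; move/cvgrPdist_le : (qF x); apply.
  have : `|fine (F `]-oo, (x - e)%R]%classic) - q (x - e) n| <= eps / 3.
    by near: n; move/cvgrPdist_le : (qF (x - e)); apply.
  have : `|geometric (tail e) (tail e) n| <= eps / 3.
    by near: n; move/cvgr0Pnorm_le : tail0; apply.
  rewrite /= -exprS !ler_norml => /andP[_ tn] /andP[_ q1] /andP[q2 _].
  by apply/andP; split; move: (pq n) (qp e n) Fe tn q1 q2; lra.
- move=> n; exact: (middle_sum_indep F1 (L_iid n) (v_meas n) (v_nn n)).
- move=> F0.
  pose S := mu ^+ 2 + sigma ^+ 2.
  have S0 : 0 <= S by rewrite addr_ge0 ?sqr_ge0.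
  have SE := law_second_moment F_nonneg F_mean F_variance.
  have muE := law_mean_norm F_nonneg F_mean.
  have msq : measurable_fun setT (fun x : R => (x ^+ 2)%:E).
    by apply/measurable_EFinP; exact: exprn_measurable.
  have mnorm : measurable_fun setT (fun x : R => `|x|%:E).
    by apply/measurable_EFinP; exact: normr_measurable.
  pose a n := fine (\int[P n]_w (X1 n w ^+ 2)%:E)%E.
  pose b n := fine (\int[P n]_w (X2 n w ^+ 2)%:E)%E.
  pose a1 n := fine (\int[P n]_w `|X1 n w|%:E)%E.
  pose b1 n := fine (\int[P n]_w `|X2 n w|%:E)%E.
  have n1 n : 0 < n.+1%:R :> R by [].
  (* The law identity integrated against the square; finiteness of both moments comes from that of
     S. *)
  have sq n : [/\ (\int[P n]_w (X1 n w ^+ 2)%:E)%E = (a n)%:E,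
      (\int[P n]_w (X2 n w ^+ 2)%:E)%E = (b n)%:E &
      n.+1%:R * b n + a n = n.+2%:R * S].
    have sq0 (x : R) : (0 <= (x ^+ 2)%:E)%E by rewrite lee_fin sqr_ge0.
    have := Lfirst_Llast_integral F1 (L_iid n) (v_meas n) (v_nn n) msq sq0.
    rewrite SE -EFinM => /(fine_weighted_sum (n1 n))[|f1 f2 e].
      by apply: integral_ge0.
    by split=> //; rewrite -[LHS]fineK.
  have norm n : [/\ (\int[P n]_w `|X1 n w|%:E)%E = (a1 n)%:E,
      (\int[P n]_w `|X2 n w|%:E)%E = (b1 n)%:E &
      n.+1%:R * b1 n + a1 n = n.+2%:R * mu].
    have norm0 (x : R) : (0 <= `|x|%:E)%E by rewrite lee_fin.
    have := Lfirst_Llast_integral F1 (L_iid n) (v_meas n) (v_nn n) mnorm norm0.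
    rewrite muE -EFinM => /(fine_weighted_sum (n1 n))[|f1 f2 e].
      by apply: integral_ge0.
    by split=> //; rewrite -[LHS]fineK.
  have a_ge0 n : 0 <= a n.
    by apply: fine_ge0; apply: integral_ge0 => w _; rewrite lee_fin sqr_ge0.
  have a1_ge0 n : 0 <= a1 n.
    by apply: fine_ge0; apply: integral_ge0 => w _; rewrite lee_fin.
  have a_le e n : 0 <= e -> a n <= e ^+ 2 + tail e ^+ n.+1 * S.
    move=> e0; have [aE _ _] := sq n.
    have := Lfirst_sq_integral F1 (L_iid n) (v_meas n) (v_nn n) F_nonneg e0.
    by rewrite [X in (X <= _)%E]aE SE -EFinM -EFinD lee_fin.
  have a_cvg : a @ \oo --> 0.
    apply: (cvg0_geometric_bound (S := S)) => // e e0; exists (tail e).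
      by rewrite tail_ge0 law_tail_lt1.
    by move=> n; apply: a_le; exact: ltW.
  have a1_le c : 0 < c -> forall n, a1 n <= c + c^-1 * a n.
    move=> c0 n; have [aE _ _] := sq n; have [a1E _ _] := norm n.
    have := Lfirst_mean_le (L n) c0.
    by rewrite [X in (X <= _)%E]a1E [X in (_ + _ * X)%E]aE -EFinM -EFinD lee_fin.
  have a1_cvg : a1 @ \oo --> 0 by exact: cvg0_square_bound a_cvg _ _.
  (* The bound [a_le] at e = 1, where the tail power is at most 1. *)
  have a_bd n : 0 <= a n <= 1 + S.
    rewrite a_ge0 (le_trans (a_le 1 n _))// expr1n lerD2l ler_piMl//.
    rewrite exprn_ile1//; apply: ltW; exact: law_tail_lt1.
  have b_cvg : b @ \oo --> S.
    by apply: cvg_weighted_mean a_bd _ => n; have [] := sq n.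
  have b1_cvg : b1 @ \oo --> mu.
    (* The constant is [a1_le] at c = 1 followed by [a_bd]. *)
    apply: (@cvg_weighted_mean R a1 b1 mu (1 + (1 + S))) => n; last first.
      by have [] := norm n.
    rewrite a1_ge0 (le_trans (a1_le 1 ltr01 n))// invr1 mul1r lerD2l.
    by have /andP[] := a_bd n.
  split.
    rewrite [X in X @ _ --> _](_ : _ = EFin \o (fun n => a1 n + b1 n)).
      apply: cvg_EFin; first by near=> n.
      by rewrite -[X in _ --> X]add0r; exact: cvgD.
    apply/funext => n; rewrite unlock /= EFinD.
    have [<- <- _] := norm n.
    exact: (first_last_mean F1 (L_iid n) (v_meas n) (v_nn n) F_nonneg).
  pose u n := fine (\int[P n]_w (FL n w ^+ 2)%:E)%E.
  have u_le c n : 0 < c -> (\int[P n]_w (FL n w ^+ 2)%:E <=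
      ((1 + c^-1) * a n + (1 + c) * b n)%:E)%E.
    move=> c0; have [aE bE _] := sq n; rewrite EFinD !EFinM -aE -bE.
    exact: (first_last_sq_le (L n) (v_meas n) c0).
  (* Any fixed c would do for finiteness; convergence then lets c depend on eps. *)
  have u_fin n : (\int[P n]_w (FL n w ^+ 2)%:E)%E \is a fin_num.
    rewrite ge0_fin_numE ?(le_lt_trans (u_le 1 n ltr01)) ?ltry//.
    by apply: integral_ge0 => w _; rewrite lee_fin sqr_ge0.
  have uE n : (\int[P n]_w (FL n w ^+ 2)%:E)%E = (u n)%:E by rewrite /u fineK.
  rewrite [X in X @ _ --> _](_ : _ = EFin \o u); last first.
    by apply/funext => n; rewrite unlock /= fineK.
  apply: cvg_EFin; first by near=> n.
  apply: (cvg_perturbed_square a_cvg b_cvg) => [n|c c0 n].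
    have [_ bE _] := sq n; rewrite -lee_fin -uE -bE.
    exact: (first_last_sq_ge F1 (L_iid n) (v_meas n) (v_nn n) F_nonneg).
  by rewrite -lee_fin -uE; exact: u_le.
Unshelve. all: by end_near. Qed.
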